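(* There is an algorithm that solves the FIFO Stack-Up problem in time $O(m^2\cdot 3^{m^2}+n+k\cdot m^2)$.
   Context: FIFO Stack-Up problem. An instance consists of a list $Q=(q_1,\ldots,q_k)$ of $k$ sequences of pairwise distinct bins, a pallet symbol ${\it plt}(b)$ (a positive integer) for every bin $b$, and a positive integer $p$. Standing assumption: every pallet symbol that occurs is carried by at least two bins. $n$ is the total number of bins and $m$ the number of distinct pallet symbols (pallets). A configuration is a tuple $(i_1,\ldots,i_k)$ with $0\le i_j\le |q_j|$, meaning that the first $i_j$ bins of $q_j$ have been removed. A pallet $t$ is open in configuration $(i_1,\ldots,i_k)$ if there are indices $j,\ell$ such that some bin for $t$ is at a position $\le i_j$ in $q_j$ and some bin for $t$ is at a position $> i_\ell$ in $q_\ell$. A transformation step removes the bin at position $i_j+1$ of some sequence $q_j$ (with $i_j<|q_j|$). A processing of $Q$ is a sequence of transformation steps from $(0,\ldots,0)$ to $(|q_1|,\ldots,|q_k|)$. The question is whether there is a processing of $Q$ such that in each configuration during the processing at most $p$ pallets are open. *)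

(* Defs.v *)
(* Mathematical Components; all numbers are natural numbers. *)
From HB Require Import structures.
From mathcomp Require Import all_boot.

Set Implicit Arguments.
Unset Strict Implicit.
Unset Printing Implicit Defensive.

(* [plt] is only constrained on the bins that occur in the sequences. *)
Record fifo_instance := FifoInstance {
  bin : eqType;
  queues : seq (seq bin);
  plt : bin -> nat;
  slots : nat;
  bins_uniq : uniq (flatten queues);
  plt_gt0 : {in flatten queues, forall b, 0 < plt b};
  plt_twice : {in flatten queues,
    forall b, 2 <= count (fun b' => plt b' == plt b) (flatten queues)};
  slots_gt0 : 0 < slots
}.

Section FifoStackUp.
Variable I : fifo_instance.

Definition pallets : seq nat :=
  undup [seq plt b | b <- flatten (queues I)].

Definition nb_queues : nat := size (queues I).
Definition nb_bins : nat := size (flatten (queues I)).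
Definition nb_pallets : nat := size pallets.

Definition queue (j : 'I_nb_queues) : seq (bin I) := nth [::] (queues I) j.

(* The bounds [c j <= size (queue j)] are not part of the type; they hold for
   every configuration that [cstep] reaches from [cstart]. *)
Definition config : Type := {ffun 'I_nb_queues -> nat}.

Definition cstart : config := [ffun => 0].
Definition cfinal : config := [ffun j => size (queue j)].

Definition is_open (c : config) (t : nat) : bool :=
  [exists j, exists l,
     (t \in [seq plt b | b <- take (c j) (queue j)])
  && (t \in [seq plt b | b <- drop (c l) (queue l)])].

Definition nb_open (c : config) : nat := count (is_open c) pallets.

Definition cstep (c c' : config) : bool :=
  [exists j, (c j < size (queue j))
          && (c' == [ffun l => if l == j then (c l).+1 else c l])].

(* [s] lists the configurations after [cstart]. *)
Definition processing (s : seq config) : bool :=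
  path cstep cstart s && (last cstart s == cfinal).

Definition stackable : Prop :=
  exists2 s : seq config,
    processing s & all (fun c => nb_open c <= slots I) (cstart :: s).

(* The slot number p, the number k of sequences, then for each sequence its
   length followed by its pallet symbols in order.  The names of the bins are
   omitted, since being open depends on their pallet symbols only. *)
Definition encode : seq nat :=
  [:: slots I, nb_queues &
      flatten [seq size q :: [seq plt b | b <- q] | q <- queues I]].

End FifoStackUp.

(* Random access machine with unit cost.  Registers are addressed by
   constants, memory only through an address held in a register.  There is no
   multiplication, division or shift, so apart from the constants of the program
   one step lengthens the numbers in use by at most one bit.  Words are
   unbounded. *)
Inductive instr : Type :=
| SetC of nat & nat           (* SetC r n    : R[r] := n *)
| Add of nat & nat & nat      (* Add r a b   : R[r] := R[a] + R[b] *)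
| Sub of nat & nat & nat      (* Sub r a b   : R[r] := R[a] - R[b], truncated *)
| Read of nat & nat           (* Read r a    : R[r] := M[R[a]] *)
| Write of nat & nat          (* Write a r   : M[R[a]] := R[r] *)
| Jump of nat                 (* Jump l      : goto l *)
| JumpZ of nat & nat.         (* JumpZ a l   : if R[a] = 0 then goto l *)

Definition program : Type := seq instr.

Record state : Type := State { pc : nat; reg : nat -> nat; cell : nat -> nat }.

Definition exec (i : instr) (s : state) : state :=
  let: State l R M := s in
  match i with
  | SetC r n => State l.+1 [eta R with r |-> n] M
  | Add r a b => State l.+1 [eta R with r |-> R a + R b] M
  | Sub r a b => State l.+1 [eta R with r |-> R a - R b] M
  | Read r a => State l.+1 [eta R with r |-> M (R a)] M
  | Write a r => State l.+1 R [eta M with R a |-> R r]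
  | Jump l' => State l' R M
  | JumpZ a l' => State (if R a == 0 then l' else l.+1) R M
  end.

(* The machine halts when the program counter leaves the program. *)
Inductive halts_in (P : program) : state -> nat -> state -> Prop :=
| HaltsNow s : size P <= pc s -> halts_in P s 0 s
| HaltsStep s i t s' : onth P (pc s) = Some i ->
    halts_in P (exec i s) t s' -> halts_in P s t.+1 s'.

(* The input occupies the first memory cells; all else is zero. *)
Definition init_state (input : seq nat) : state :=
  State 0 (fun=> 0) (nth 0 input).

(* On [input], [P] halts after [t] steps, and register 0 then holds the answer
   (1 for yes, 0 for no) to the question [A]. *)
Definition answers_in (P : program) (input : seq nat) (A : Prop) (t : nat) :=
  exists2 s : state, halts_in P (init_state input) t s
    & (A -> reg s 0 = 1) /\ (~ A -> reg s 0 = 0).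

(* Main.v *)
Require Import Defs.
From HB Require Import structures.
From mathcomp Require Import all_boot.
From mathcomp Require Import zify.

(** Write [w -> t] if in some queue a bin for [t] occurs at or after the first
    bin for [w].  Given a rank [r t] for every pallet, remove the bins in
    rounds: round [i] removes all bins that can be reached through pallets of rank at
    most [i].  A pallet [t] that is open at some time in round [i] satisfies
    [r t <= i] and [w -> t] for some [w] with [i <= r w].  Conversely, rank the
    pallets by the time at which a given processing first touches them; then all
    [t] of this kind are open when the pallet of rank [i] is first touched.
    Hence the instance is stackable iff for some ranks in [{0, ..., m - 1}] there
    are at most [p] such [t] for every [i].

    The first and last position of every pallet in a queue are found in one pass
    over the queue, which gives the relation [->] in time [O(n + k m^2)].  Trying
    all [m ^ m] rankings, each in time [O(m^3)], is fast enough because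
    [m ^ m * m ^ 3 <= m ^ 2 * 3 ^ (m ^ 2)]. *)

Set Implicit Arguments.
Unset Strict Implicit.
Unset Printing Implicit Defensive.

(** * A loop language and its compilation *)

Inductive exp : Type :=
| Cst of nat
| Base
| Var of nat
| Mem of exp
| Arr of nat & exp
| Plus of exp & exp
| Minus of exp & exp.

(* [For x y c] runs [c] with [x] counting from 0 to [y - 1].  As [wf] forbids [c]
   to write [x] or [y], all programs terminate, so that [run] and [cost] below
   can be functions. *)
Inductive cmd : Type :=
| Skip
| Asg of nat & exp
| Sto of nat & exp & exp
| Seq of cmd & cmd
| IfZ of exp & cmd & cmd
| For of nat & nat & cmd.

Declare Scope cmd_scope.
Delimit Scope cmd_scope with cmd.
Bind Scope cmd_scope with cmd.
Notation "c1 ;; c2" := (Seq c1 c2)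
  (at level 60, right associativity) : cmd_scope.

Record store : Type := Store { va : nat -> nat; ar : nat -> nat -> nat }.

Definition upd T (f : nat -> T) x v : nat -> T :=
  fun z => if z == x then v else f z.
Arguments upd T f x v z /.

Definition setv s x v := Store (upd (va s) x v) (ar s).
Definition seta s a i v := Store (va s) (upd (ar s) a (upd (ar s a) i v)).

Fixpoint writes c : seq nat :=
  match c with
  | Skip | Sto _ _ _ => [::]
  | Asg x _ => [:: x]
  | Seq c1 c2 | IfZ _ c1 c2 => writes c1 ++ writes c2
  | For x _ c => x :: writes c
  end.

Fixpoint awrites c : seq nat :=
  match c with
  | Skip | Asg _ _ => [::]
  | Sto a _ _ => [:: a]
  | Seq c1 c2 | IfZ _ c1 c2 => awrites c1 ++ awrites c2
  | For _ _ c => awrites c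
  end.

Fixpoint wf_exp e : bool :=
  match e with
  | Cst _ | Base | Var _ => true
  | Mem e => wf_exp e
  | Arr a e => (a < 8) && wf_exp e
  | Plus e1 e2 | Minus e1 e2 => wf_exp e1 && wf_exp e2
  end.

Fixpoint wf c : bool :=
  match c with
  | Skip => true
  | Asg _ e => wf_exp e
  | Sto a e1 e2 => [&& a < 8, wf_exp e1 & wf_exp e2]
  | Seq c1 c2 => wf c1 && wf c2
  | IfZ e c1 c2 => [&& wf_exp e, wf c1 & wf c2]
  | For x y c => [&& x != y, x \notin writes c, y \notin writes c & wf c]
  end.

(* Variables live in the even registers, register 1 holds the base of the
   arrays, and the other odd registers are scratch space. *)
Definition temp d := d.*2.+3.
Arguments temp : simpl never.

(** In the absence of multiplication, three doublings give the factor 8. Interleaving eight arrays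
    above the input leaves each of them unbounded. *)
Definition caddr a d : program :=
  [:: Add (temp d) (temp d) (temp d); Add (temp d) (temp d) (temp d);
      Add (temp d) (temp d) (temp d); Add (temp d) (temp d) 1;
      SetC (temp d.+1) a; Add (temp d) (temp d) (temp d.+1)].

(** The depth [d] acts as a stack pointer: the value ends up in [temp d] and lower scratch registers
    survive, so a left operand is kept while the right one is computed at [d.+1]. *)
Fixpoint cexp e d : program :=
  match e with
  | Cst n => [:: SetC (temp d) n]
  | Base => [:: SetC (temp d) 0; Add (temp d) (temp d) 1]
  | Var x => [:: SetC (temp d) 0; Add (temp d) (temp d) x.*2]
  | Mem e => cexp e d ++ [:: Read (temp d) (temp d)]
  | Arr a e => cexp e d ++ caddr a d ++ [:: Read (temp d) (temp d)]
  | Plus e1 e2 =>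
      cexp e1 d ++ cexp e2 d.+1 ++ [:: Add (temp d) (temp d) (temp d.+1)]
  | Minus e1 e2 =>
      cexp e1 d ++ cexp e2 d.+1 ++ [:: Defs.Sub (temp d) (temp d) (temp d.+1)]
  end.

(** Jumps are absolute, hence the parameter [o], the address at which the code will be placed. A
    loop tests [y - x] for zero, which with truncated subtraction means [y <= x]. *)
Fixpoint compile o c : program :=
  match c with
  | Skip => [::]
  | Asg x e => cexp e 0 ++ [:: SetC x.*2 0; Add x.*2 x.*2 (temp 0)]
  | Sto a e1 e2 =>
      cexp e1 0 ++ caddr a 0 ++ cexp e2 1 ++ [:: Write (temp 0) (temp 1)]
  | Seq c1 c2 => compile o c1 ++ compile (o + size (compile o c1)) c2
  | IfZ e c1 c2 =>
      let pe := cexp e 0 in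
      let p2 := compile (o + size pe).+1 c2 in
      let o1 := ((o + size pe).+1 + size p2).+1 in
      let p1 := compile o1 c1 in
      pe ++ JumpZ (temp 0) o1 :: p2 ++ Jump (o1 + size p1) :: p1
  | For x y c =>
      let p := compile o.+3 c in
      [:: SetC x.*2 0, Defs.Sub (temp 0) y.*2 x.*2,
          JumpZ (temp 0) (o.+3 + size p).+3 & p] ++
      [:: SetC (temp 0) 1; Add x.*2 x.*2 (temp 0); Jump o.+1]
  end.

(** * Execution of code fragments *)

Inductive steps (P : program) : state -> nat -> state -> Prop :=
| Steps0 s : steps P s 0 s
| StepsS s i t s' : onth P (pc s) = Some i ->
    steps P (exec i s) t s' -> steps P s t.+1 s'.

Lemma steps_trans P s1 t1 s2 t2 s3 :
  steps P s1 t1 s2 -> steps P s2 t2 s3 -> steps P s1 (t1 + t2) s3.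
Proof.
elim=> [//|s i t s' Pi _ IH /IH]; rewrite addSn; exact: StepsS.
Qed.

Lemma steps_halts P s1 t s2 :
  steps P s1 t s2 -> size P <= pc s2 -> halts_in P s1 t s2.
Proof.
elim=> [s|s i t' s' Pi _ IH /IH]; first exact: HaltsNow.
exact: HaltsStep Pi.
Qed.

Lemma step_at P o R M i t s : onth P o = Some i ->
  steps P (exec i (State o R M)) t s -> steps P (State o R M) t.+1 s.
Proof. by move=> Pi; apply: StepsS. Qed.

Lemma steps_eq P s t t' o o' R M :
  steps P s t (State o R M) -> t = t' -> o = o' -> steps P s t' (State o' R M).
Proof. by move=> st <- <-. Qed.

Definition code_at (P : program) o (l : program) :=
  forall i, i < size l -> onth P (o + i) = onth l i.

Lemma code_at_cat P o l1 l2 : code_at P o (l1 ++ l2) ->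
  code_at P o l1 /\ code_at P (o + size l1) l2.
Proof.
move=> cP; split=> i lti.
  by rewrite cP ?size_cat ?ltn_addr // onth_cat lti.
rewrite -addnA cP ?size_cat ?ltn_add2l // onth_cat.
by rewrite ltnNge leq_addr addKn.
Qed.

Lemma code_at_cons P o i l : code_at P o (i :: l) ->
  onth P o = Some i /\ code_at P o.+1 l.
Proof.
move=> cP; split=> [|j ltj]; first by have := cP 0; rewrite addn0; exact.
by rewrite addSnnS cP.
Qed.

Definition exec_seq (l : program) (s : state) := foldl (fun s i => exec i s) s l.
Arguments exec_seq : simpl never.

Definition straight i :=
  match i with Jump _ | JumpZ _ _ => false | _ => true end.

Lemma steps_straight P l s : all straight l -> code_at P (pc s) l ->
  steps P s (size l) (exec_seq l s).
Proof.
elim: l s => [|i l IH] s /=; first by move=> *; exact: Steps0.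
case/andP=> si sl /code_at_cons[Pi cl]; apply: StepsS Pi _.
apply: IH => //; by case: s i si cl => [o R M] [].
Qed.

Lemma cexp_straight e d : all straight (cexp e d).
Proof.
by elim: e d => //= [e IH|a e IH|e1 IH1 e2 IH2|e1 IH1 e2 IH2] d;
   rewrite !all_cat ?IH ?IH1 ?IH2.
Qed.

(** * Semantics of the loop language and correctness of the compiler *)

Section Semantics.
Variables (base : nat) (inp : nat -> nat).

(* Cell [i] of array [a < 8] has address [8 * i + base + a]. *)
Definition mem s i :=
  if i < base then inp i else ar s ((i - base) %% 8) ((i - base) %/ 8).

Fixpoint eval s e : nat :=
  match e with
  | Cst n => n
  | Base => base
  | Var x => va s x
  | Mem e => mem s (eval s e)
  | Arr a e => ar s a (eval s e)
  | Plus e1 e2 => eval s e1 + eval s e2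
  | Minus e1 e2 => eval s e1 - eval s e2
  end.

Fixpoint run c s : store :=
  match c with
  | Skip => s
  | Asg x e => setv s x (eval s e)
  | Sto a e1 e2 => seta s a (eval s e1) (eval s e2)
  | Seq c1 c2 => run c2 (run c1 s)
  | IfZ e c1 c2 => if eval s e == 0 then run c1 s else run c2 s
  | For x y c =>
      iter (va s y) (fun s' => setv (run c s') x (va s' x).+1) (setv s x 0)
  end.

(** The exact number of machine steps. The length of jump-free code does not depend on its address,
    so 0 serves as offset. A taken round of a loop adds the two instructions of the test and the
    three that increment and jump back; the initialisation and the last test make up the 3. *)
Fixpoint cost c s : nat :=
  match c with
  | Seq c1 c2 => cost c1 s + cost c2 (run c1 s)
  | IfZ e c1 c2 => (size (cexp e 0)).+1 +
      (if eval s e == 0 then cost c1 s else (cost c2 s).+1)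
  | For x y c =>
      3 + \sum_(i < va s y)
        (cost c (iter i (fun s' => setv (run c s') x (va s' x).+1) (setv s x 0))
         + 5)
  | _ => size (compile 0 c)
  end.

Lemma mem_arr s a i : a < 8 -> mem s (i.*2.*2.*2 + base + a) = ar s a i.
Proof.
move=> lta; rewrite /mem ifN; last by lia.
by congr (ar s _ _); lia.
Qed.

Lemma mem_seta s a i v j : a < 8 ->
  mem (seta s a i v) j = if j == i.*2.*2.*2 + base + a then v else mem s j.
Proof.
move=> lta; rewrite /mem /= /upd.
have [ltj|lej] := ltnP j base; first by rewrite ifN //; lia.
case: eqP => [<-|neq_a]; last by rewrite ifN //; lia.
by congr (if _ then v else _); lia.
Qed.

(** Odd registers other than 1 are left unconstrained, so that scratch computations preserve
    [sim]. *)
Definition sim s R M :=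
  [/\ forall x, R x.*2 = va s x, R 1 = base & M =1 mem s].

Lemma exec_seq_cat l1 l2 st :
  exec_seq (l1 ++ l2) st = exec_seq l2 (exec_seq l1 st).
Proof. exact: foldl_cat. Qed.

Definition scratch d r := odd r && (temp d <= r).

Lemma sim_scratch s R M R' d : sim s R M ->
  (forall r, ~~ scratch d r -> R' r = R r) -> sim s R' M.
Proof.
case=> RV R1 MM RR; split=> // [x|]; rewrite RR ?RV //.
by rewrite /scratch odd_double.
Qed.

Lemma scratchN d r : ~~ scratch d r ->
  (r == temp d) = false /\ (r == temp d.+1) = false.
Proof.
by rewrite /scratch /temp => sr; split; case: eqP sr => // ->;
   rewrite /= odd_double /=; lia.
Qed.

Lemma temp_neqS d : (temp d == temp d.+1) = false.
Proof. by rewrite /temp; lia. Qed.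

Lemma scratchW d r : ~~ scratch d r -> ~~ scratch d.+1 r.
Proof.
by apply: contra => /andP[or ltr]; rewrite /scratch or /=; move: ltr; rewrite /temp; lia.
Qed.

Lemma scratch_temp d : ~~ scratch d.+1 (temp d).
Proof. by rewrite /scratch /temp; lia. Qed.

Lemma caddrP s a d l R M : sim s R M -> exists R',
  [/\ exec_seq (caddr a d) (State l R M) = State (l + size (caddr a d)) R' M,
      R' (temp d) = (R (temp d)).*2.*2.*2 + base + a
    & forall r, ~~ scratch d r -> R' r = R r].
Proof.
case=> _ R1 _; eexists; split; first by rewrite addnC; reflexivity.
  by rewrite /= !eqxx temp_neqS !addnn R1.
by move=> r /scratchN[sr1 sr2] /=; rewrite !sr1 sr2.
Qed.

Lemma caddr_straight a d : all straight (caddr a d).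
Proof. by []. Qed.

Opaque caddr.

(** The last clause is what makes the induction work for binary operators: evaluating the right
    operand at [d.+1] leaves [temp d] alone. *)
Lemma cexpP s e d l R M : wf_exp e -> sim s R M -> exists R',
  [/\ exec_seq (cexp e d) (State l R M) = State (l + size (cexp e d)) R' M,
      R' (temp d) = eval s e & forall r, ~~ scratch d r -> R' r = R r].
Proof.
elim: e d l R => /= [n||x|e IH|a e IH|e1 IH1 e2 IH2|e1 IH1 e2 IH2] d l R.
- move=> _ _; eexists; split; first by rewrite addn1; reflexivity.
    by rewrite /= eqxx.
  by move=> r /scratchN[sr _] /=; rewrite sr.
- move=> _ [_ R1 _]; eexists; split; first by rewrite addn2; reflexivity.
    by rewrite /= !eqxx R1.
  by move=> r /scratchN[sr _] /=; rewrite !sr.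
- move=> _ [Rx _ _]; eexists; split; first by rewrite addn2; reflexivity.
    rewrite /= !eqxx; case: eqP => [xE|_]; last by rewrite Rx.
    by have := odd_double x; rewrite xE /temp /= odd_double.
  by move=> r /scratchN[sr _] /=; rewrite !sr.
- move=> we sm; have [R' [eR Re fR]] := IH d l R we sm.
  rewrite exec_seq_cat eR size_cat addnA; eexists; split.
  + by rewrite addn1; reflexivity.
  + by rewrite /= eqxx Re; case: sm.
  + by move=> r sr /=; have [-> _] := scratchN sr; apply: fR.
- case/andP=> lta we sm; have [R' [eR Re fR]] := IH d l R we sm.
  rewrite exec_seq_cat eR exec_seq_cat 2!size_cat 2!addnA.
  have sm' := sim_scratch sm fR.
  have [R2 [-> Ra fR2]] := caddrP a d (l + size (cexp e d)) sm'.
  eexists; split.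
  + by rewrite addn1; reflexivity.
  + by rewrite /= eqxx Ra Re; case: sm => _ _ ->; rewrite mem_arr.
  + by move=> r sr /=; have [-> _] := scratchN sr; rewrite fR2 ?fR.
- case/andP=> we1 we2 sm; have [R1 [eR1 Re1 fR1]] := IH1 d l R we1 sm.
  rewrite exec_seq_cat eR1 exec_seq_cat 2!size_cat 2!addnA.
  have sm1 := sim_scratch sm fR1.
  have [R2 [-> Re2 fR2]] := IH2 d.+1 (l + size (cexp e1 d)) R1 we2 sm1.
  eexists; split.
  + by rewrite addn1; reflexivity.
  + by rewrite /= eqxx Re2 fR2 ?scratch_temp // Re1.
  + move=> r sr /=; have [-> _] := scratchN sr.
    by rewrite fR2 ?scratchW // fR1.
- case/andP=> we1 we2 sm; have [R1 [eR1 Re1 fR1]] := IH1 d l R we1 sm.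
  rewrite exec_seq_cat eR1 exec_seq_cat 2!size_cat 2!addnA.
  have sm1 := sim_scratch sm fR1.
  have [R2 [-> Re2 fR2]] := IH2 d.+1 (l + size (cexp e1 d)) R1 we2 sm1.
  eexists; split.
  + by rewrite addn1; reflexivity.
  + by rewrite /= eqxx Re2 fR2 ?scratch_temp // Re1.
  + move=> r sr /=; have [-> _] := scratchN sr.
    by rewrite fR2 ?scratchW // fR1.
Qed.

Lemma cexp_steps P s e o R M :
  wf_exp e -> sim s R M -> code_at P o (cexp e 0) -> exists R',
  [/\ steps P (State o R M) (size (cexp e 0))
        (State (o + size (cexp e 0)) R' M),
      R' (temp 0) = eval s e & sim s R' M].
Proof.
move=> we sm ce; have [R' [eR Re fR]] := cexpP 0 o we sm.
exists R'; split=> //; last exact: sim_scratch sm fR.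
by rewrite -eR; apply: steps_straight => //; apply: cexp_straight.
Qed.

Lemma va_run c s x : x \notin writes c -> va (run c s) x = va s x.
Proof.
elim: c s => //= [y e|c1 IH1 c2 IH2|e c1 IH1 c2 IH2|y z c IH] s.
- by rewrite inE /upd => /negPf->.
- by rewrite mem_cat negb_or => /andP[x1 x2]; rewrite IH2 ?IH1.
- by rewrite mem_cat negb_or => /andP[x1 x2]; case: ifP; rewrite ?IH1 ?IH2.
- rewrite inE negb_or => /andP[/negPf xy xc].
  elim: (va s z) => [|n IHn] /=; first by rewrite /upd xy.
  by rewrite xy IH.
Qed.

Lemma ar_run c s a : a \notin awrites c -> ar (run c s) a = ar s a.
Proof.
elim: c s => //= [b e1 e2|c1 IH1 c2 IH2|e c1 IH1 c2 IH2|y z c IH] s.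
- by rewrite inE /upd => /negPf->.
- by rewrite mem_cat negb_or => /andP[x1 x2]; rewrite IH2 ?IH1.
- by rewrite mem_cat negb_or => /andP[x1 x2]; case: ifP; rewrite ?IH1 ?IH2.
- by move=> ac; elim: (va s z) => [|n IHn] //=; rewrite IH.
Qed.

Definition for_step x c s := setv (run c s) x (va s x).+1.
Definition for_state x c i s := iter i (for_step x c) (setv s x 0).

Lemma for_state_ctr x c i s : va (for_state x c i s) x = i.
Proof.
by elim: i => [|i IH]; rewrite /for_state /= /upd eqxx //; rewrite -/(for_state x c i s) IH.
Qed.

Lemma for_stateS x c i s :
  for_state x c i.+1 s = setv (run c (for_state x c i s)) x i.+1.
Proof.
by rewrite {1}/for_state iterS -/(for_state x c i s) /for_step for_state_ctr.
Qed.

Lemma for_state_va x c i s y : y \notin writes (For x y c) ->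
  va (for_state x c i s) y = va s y.
Proof.
rewrite inE negb_or => /andP[/negPf yx yc].
elim: i => [|i IH]; rewrite /for_state /= /upd yx //.
by rewrite va_run.
Qed.

Lemma sim_setv s R M x v : sim s R M -> sim (setv s x v) [eta R with x.*2 |-> v] M.
Proof.
case=> RV R1 MM; split=> [z||//] /=.
- by rewrite (inj_eq double_inj) /upd RV.
- by case: eqP => // xE; have := odd_double x; rewrite -xE.
Qed.

Lemma sim_temp s R M v d : sim s R M -> sim s [eta R with temp d |-> v] M.
Proof.
move=> sm; apply: (@sim_scratch _ _ _ _ d sm) => r /scratchN[sr _] /=.
by rewrite sr.
Qed.

Definition for_cost x c n s := \sum_(i < n) (cost c (for_state x c i s) + 5).

(** From here on, correctness and running time can be studied through [run] and [cost] alone. The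
    address [o] must be general, since subcommands are placed at other addresses. *)
Lemma compileP P c o s R M : wf c -> code_at P o (compile o c) -> sim s R M ->
  exists R' M', steps P (State o R M) (cost c s)
                  (State (o + size (compile o c)) R' M') /\ sim (run c s) R' M'.
Proof.
elim: c o s R M => [|x e|a e1 e2|c1 IH1 c2 IH2|e c1 IH1 c2 IH2|x y c IH] o s R M.
- by move=> _ _ sm; exists R, M; rewrite addn0; split=> //; apply: Steps0.
- move=> we /code_at_cat[ce ci] sm.
  have [R' [st Re sm']] := cexp_steps we sm ce.
  eexists _, M; split.
    rewrite /= !size_cat addnA; apply: (steps_trans st).
    by rewrite addn2; apply: (steps_straight (s := State _ R' M)) ci.
  split=> [z||] /=; case: sm' => RV R1 MM //; last first.
    by have := odd_double x; case: eqP => // <-.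
  rewrite (inj_eq double_inj) eqxx /upd; case: eqP => // _.
  by case: eqP => [xE|_]; rewrite ?Re //; have := odd_double x; rewrite -xE.
- case/and3P=> lta we1 we2 /code_at_cat[ce1 /code_at_cat[ca /code_at_cat[ce2 cw]]] sm.
  have [R1 [st1 Re1 sm1]] := cexp_steps we1 sm ce1.
  have [R2 [eR2 Ra fR2]] := caddrP a 0 (o + size (cexp e1 0)) sm1.
  have sm2 := sim_scratch sm1 fR2.
  have [R3 [eR3 Re3 fR3]] := cexpP 1 (o + size (cexp e1 0) + size (caddr a 0)) we2 sm2.
  have sm3 := sim_scratch sm2 fR3.
  have st2 := steps_straight (s := State _ R1 M) (caddr_straight _ _) ca.
  have st3 := steps_straight (s := State _ R2 M) (cexp_straight _ _) ce2.
  rewrite eR2 in st2; rewrite eR3 in st3.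
  have wS : all straight [:: Write (temp 0) (temp 1)] by [].
  have := steps_straight (s := State _ R3 M) wS cw.
  move/(steps_trans (steps_trans (steps_trans st1 st2) st3)) => /= st.
  eexists _, _; split.
    by rewrite /= !size_cat !addnA /= !addn1; rewrite !addn1 in st; exact: st.
  case: sm3 => RV RB MM; split=> //= z.
  by rewrite /= mem_seta // MM Re3 fR3 ?scratch_temp // Ra Re1.
- case/andP=> w1 w2 /code_at_cat[cc1 cc2] sm.
  have [R1 [M1 [st1 sm1]]] := IH1 _ _ _ _ w1 cc1 sm.
  have [R2 [M2 [st2 sm2]]] := IH2 _ _ _ _ w2 cc2 sm1.
  exists R2, M2; split=> //=; rewrite size_cat addnA.
  exact: steps_trans st1 st2.
- case/and3P=> we w1 w2 cif sm.
  set o2 := (o + size (cexp e 0)).+1.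
  set o1 := (o2 + size (compile o2 c2)).+1.
  have eif : compile o (IfZ e c1 c2) = cexp e 0 ++ JumpZ (temp 0) o1 ::
    compile o2 c2 ++ Jump (o1 + size (compile o1 c1)) :: compile o1 c1 by [].
  move: cif; rewrite eif => /code_at_cat[ce /code_at_cons[Pj]].
  case/code_at_cat=> cc2 /code_at_cons[Pe cc1].
  have sz : size (compile o (IfZ e c1 c2)) = size (cexp e 0)
      + (size (compile o2 c2) + (size (compile o1 c1)).+1).+1.
    by rewrite eif size_cat /= size_cat.
  rewrite -eif; have [R0 [st0 Re sm0]] := cexp_steps we sm ce.
  have [v0|vn0] := eqVneq (eval s e) 0.
    have [R1 [M1 [st1 sm1]]] := IH1 _ _ _ _ w1 cc1 sm0.
    exists R1, M1; split; last by rewrite /= v0.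
    apply: (@steps_eq _ _ (size (cexp e 0) + (cost c1 s).+1)).
    - by apply: (steps_trans st0); apply: (step_at Pj); rewrite /= Re v0; exact: st1.
    - by rewrite /= v0 /=; lia.
    - by rewrite sz /o1 /o2; lia.
  have [R2 [M2 [st2 sm2]]] := IH2 _ _ _ _ w2 cc2 sm0.
  exists R2, M2; split; last by rewrite /= (negPf vn0).
  apply: (@steps_eq _ _ (size (cexp e 0) + (cost c2 s + 1).+1)).
  - apply: (steps_trans st0); apply: (step_at Pj).
    rewrite /= Re (negPf vn0); apply: (steps_trans st2).
    by apply: (step_at Pe); exact: Steps0.
  - by rewrite /= (negPf vn0); lia.
  - by rewrite sz /o1 /o2; lia.
- case/and4P=> xy xc yc wc.
  have efor : compile o (For x y c) = let p := compile o.+3 c in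
    [:: SetC x.*2 0, Defs.Sub (temp 0) y.*2 x.*2,
        JumpZ (temp 0) (o.+3 + size p).+3 & p] ++
    [:: SetC (temp 0) 1; Add x.*2 x.*2 (temp 0); Jump o.+1] by [].
  rewrite efor; move: (compile o.+3 c) (IH o.+3) => /= p IHp.
  move=> /code_at_cons[P0 /code_at_cons[P1 /code_at_cons[P2]]].
  move=> /code_at_cat[cc cf] sm.
  have yw: y \notin writes (For x y c) by rewrite inE negb_or eq_sym xy.
  (* After [i] rounds the machine is back at the test, at address [o.+1]; the extra step is the
     initialisation of [x]. *)
  have loop i : i <= va s y -> exists R' M',
      steps P (State o R M) (for_cost x c i s).+1 (State o.+1 R' M') /\
      sim (for_state x c i s) R' M'.
    elim: i => [_|i IHi lti].
      exists [eta R with x.*2 |-> 0], M; split; last exact: sim_setv.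
      rewrite /for_cost big_ord0; apply: (step_at P0); exact: Steps0.
    have [R1 [M1 [st1 sm1]]] := IHi (ltnW lti).
    have [RV _ _] := sm1.
    have ex := RV x; have ey := RV y.
    rewrite for_state_ctr in ex; rewrite for_state_va // in ey.
    have [R2 [M2 [st2 sm2]]] := IHp _ _ _ wc cc (sim_temp (va s y - i) 0 sm1).
    case/code_at_cons: cf => Q0 /code_at_cons[Q1 /code_at_cons[Q2 _]].
    have [ex2 _ _] := sm2.
    exists [eta [eta R2 with temp 0 |-> 1] with x.*2 |-> i.+1], M2; split.
      apply: (@steps_eq _ _ ((for_cost x c i s).+1
                + (cost c (for_state x c i s) + 3).+2)) => //.
      + apply: (steps_trans st1); apply: (step_at P1); rewrite /= ex ey.
        apply: (step_at P2); rewrite /= ifN; last by lia.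
        apply: (steps_trans st2); apply: (step_at Q0).
        apply: (step_at Q1); rewrite /= ex2 ifN; last by rewrite /temp; lia.
        rewrite va_run // for_state_ctr addn1.
        by apply: (step_at Q2); exact: Steps0.
      + by rewrite /for_cost big_ord_recr /=; lia.
    rewrite for_stateS.
    exact: sim_setv (sim_temp 1 0 sm2).
  have [R1 [M1 [st1 sm1]]] := loop _ (leqnn _).
  have [RV _ _] := sm1.
  have ex := RV x; have ey := RV y.
  rewrite for_state_ctr in ex; rewrite for_state_va // in ey.
  exists [eta R1 with temp 0 |-> 0], M1; split; last exact: sim_temp.
  apply: (@steps_eq _ _ ((for_cost x c (va s y) s).+1 + 2)).
  - apply: (steps_trans st1); apply: (step_at P1); rewrite /= ex ey subnn.
    by apply: (step_at P2); exact: Steps0.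
  - by rewrite -[RHS]/(3 + for_cost x c (va s y) s); lia.
  - by rewrite /= size_cat /=; lia.
Qed.
End Semantics.

(** * Invariants of loops *)

Section Rules.
Variables (base : nat) (inp : nat -> nat).
Local Notation run := (run base inp).
Local Notation cost := (cost base inp).

Lemma run_seq c1 c2 s : run (c1 ;; c2)%cmd s = run c2 (run c1 s).
Proof. by []. Qed.

Lemma run_if e c1 c2 s :
  run (IfZ e c1 c2) s = if eval base inp s e == 0 then run c1 s else run c2 s.
Proof. by []. Qed.

(* What the body of a loop may assume about the state [s'] it starts in, [s]
   being the state before the loop. *)
Definition for_frame x y c s i s' :=
  [/\ i < va s y, va s' x = i,
      forall z, z \notin writes (For x y c) -> va s' z = va s z
    & forall a, a \notin awrites c -> ar s' a = ar s a].

(** Describes every intermediate state: correctness uses the last one, the cost estimate all of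
    them. *)
Lemma for_states x y c s (Inv : nat -> store -> Prop) :
  Inv 0 (setv s x 0) ->
  (forall i s', for_frame x y c s i s' -> Inv i s' ->
     Inv i.+1 (setv (run c s') x i.+1)) ->
  (forall i, i < va s y -> for_frame x y c s i (for_state base inp x c i s)) /\
  (forall i, i <= va s y -> Inv i (for_state base inp x c i s)).
Proof.
move=> Inv0 InvS; have ff i : i < va s y ->
    for_frame x y c s i (for_state base inp x c i s).
  move=> lti; split=> // [|z|a]; first exact: for_state_ctr.
    rewrite inE negb_or => /andP[/negPf zx zc].
    by elim: i {lti} => [|i IH]; rewrite /for_state /= /upd zx // va_run.
  by move=> ac; elim: i {lti} => [|i IH] //; rewrite for_stateS /= ar_run.
split=> //; elim=> [//|i IH] lti; rewrite for_stateS.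
by apply: InvS (ff _ lti) (IH (ltnW lti)).
Qed.

Lemma for_inv x y c s (Inv : nat -> store -> Prop) :
  Inv 0 (setv s x 0) ->
  (forall i s', for_frame x y c s i s' -> Inv i s' ->
     Inv i.+1 (setv (run c s') x i.+1)) ->
  Inv (va s y) (run (For x y c) s).
Proof. by move=> Inv0 InvS; have [_ /(_ _ (leqnn _))] := for_states Inv0 InvS. Qed.

Lemma for_cost_le x y c s (Inv : nat -> store -> Prop) T :
  Inv 0 (setv s x 0) ->
  (forall i s', for_frame x y c s i s' -> Inv i s' ->
     Inv i.+1 (setv (run c s') x i.+1)) ->
  (forall i s', for_frame x y c s i s' -> Inv i s' -> cost c s' <= T i) ->
  cost (For x y c) s <= 3 + \sum_(i < va s y) (T i + 5).
Proof.
move=> Inv0 InvS cT; have [ff Invi] := for_states Inv0 InvS.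
rewrite -[cost _ _]/(3 + for_cost base inp x c (va s y) s) leq_add2l.
apply: leq_sum => i _; rewrite leq_add2r.
exact: cT (ff _ (ltn_ord i)) (Invi _ (ltnW (ltn_ord i))).
Qed.

End Rules.

(** * Polynomial bounds on the cost *)

Fixpoint loops_over z c : bool :=
  match c with
  | Seq c1 c2 | IfZ _ c1 c2 => loops_over z c1 && loops_over z c2
  | For _ y c => (y == z) && loops_over z c
  | _ => true
  end.

(** A state-independent estimate in which every loop makes [n] rounds. Adding both branches of a
    conditional, instead of taking a maximum, keeps it a polynomial in [n]. *)
Fixpoint bound (c : cmd) (n : nat) : nat :=
  match c with
  | Seq c1 c2 => bound c1 n + bound c2 n
  | IfZ e c1 c2 => size (cexp e 0) + bound c1 n + bound c2 n + 2
  | For _ _ c => 3 + n * (bound c n + 5)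
  | _ => size (compile 0 c)
  end.

Fixpoint depth c : nat :=
  match c with
  | Seq c1 c2 | IfZ _ c1 c2 => maxn (depth c1) (depth c2)
  | For _ _ c => (depth c).+1
  | _ => 0
  end.

Lemma cost_bound base inp z c s : loops_over z c -> z \notin writes c ->
  cost base inp c s <= bound c (va s z).
Proof.
elim: c s => [|||c1 IH1 c2 IH2|e c1 IH1 c2 IH2|x y c IH] //= s.
- case/andP=> l1 l2; rewrite mem_cat negb_or => /andP[z1 z2].
  by rewrite leq_add ?IH1 // -(va_run base inp s z1) IH2.
- case/andP=> l1 l2; rewrite mem_cat negb_or => /andP[z1 z2].
  have := IH1 s l1 z1; have := IH2 s l2 z2; case: ifP => _; lia.
- case/andP=> /eqP-> lc zc; rewrite leq_add2l.
  have zW : z \notin writes c by move: zc; rewrite inE negb_or => /andP[].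
  apply: (@leq_trans (\sum_(i < va s z) (bound c (va s z) + 5))); last first.
    by rewrite sum_nat_const card_ord.
  apply: leq_sum => i _; rewrite leq_add2r.
  by have := IH (for_state base inp x c i s) lc zW; rewrite for_state_va.
Qed.

Lemma bound_mono c n n' : n <= n' -> bound c n <= bound c n'.
Proof.
move=> len; elim: c => //= [c1 IH1 c2 IH2|e c1 IH1 c2 IH2|x y c IH].
- exact: leq_add.
- by rewrite leq_add2r !leq_add.
- by rewrite leq_add2l leq_mul ?leq_add2r.
Qed.

(** A polynomial of degree [depth c] with natural coefficients, whose sum is the value at 1; for
    positive [n] each monomial is at most the leading power. *)
Lemma bound_leq c n : 0 < n -> bound c n <= bound c 1 * n ^ depth c.
Proof.
move=> n0; elim: c => [|x e|a e1 e2|c1 IH1 c2 IH2|e c1 IH1 c2 IH2|x y c IH];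
  rewrite /= ?expn0 ?muln1 //.
- rewrite mulnDl; apply: leq_add.
    by apply: (leq_trans IH1); rewrite leq_mul2l leq_pexp2l ?leq_maxl ?orbT.
  by apply: (leq_trans IH2); rewrite leq_mul2l leq_pexp2l ?leq_maxr ?orbT.
- have le1 : bound c1 n <= bound c1 1 * n ^ maxn (depth c1) (depth c2).
    by apply: (leq_trans IH1); rewrite leq_mul2l leq_pexp2l ?leq_maxl ?orbT.
  have le2 : bound c2 n <= bound c2 1 * n ^ maxn (depth c1) (depth c2).
    by apply: (leq_trans IH2); rewrite leq_mul2l leq_pexp2l ?leq_maxr ?orbT.
  have : 0 < n ^ maxn (depth c1) (depth c2) by rewrite expn_gt0 n0.
  by nia.
- have : 0 < n ^ depth c by rewrite expn_gt0 n0.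
  rewrite expnS; nia.
Qed.

(** * The search for a ranking *)

Notation vAns := 0 (only parsing).
Notation vK := 1 (only parsing).
Notation vQ := 2 (only parsing).
Notation vA := 3 (only parsing).
Notation vLen := 4 (only parsing).
Notation vB := 5 (only parsing).
Notation vS := 6 (only parsing).
Notation vX := 7 (only parsing).
Notation vM := 8 (only parsing).
Notation vRow := 9 (only parsing).
Notation vU := 10 (only parsing).
Notation vV := 11 (only parsing).
Notation vN := 12 (only parsing).
Notation vTmp := 13 (only parsing).
Notation vC := 14 (only parsing).
Notation vI := 15 (only parsing).
Notation vT := 16 (only parsing).
Notation vW := 17 (only parsing).
Notation vF := 18 (only parsing).
Notation vCnt := 19 (only parsing).
Notation vBad := 20 (only parsing).
Notation vCarry := 21 (only parsing).
Notation vJ := 22 (only parsing).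

Notation aFirst := 0 (only parsing).
Notation aLast := 1 (only parsing).
Notation aPal := 2 (only parsing).
Notation aMat := 3 (only parsing).
Notation aRank := 4 (only parsing).

Definition incr x := Asg x (Plus (Var x) (Cst 1)).

(** [vRow] holds [w * base], updated by addition. The rows of the matrix have stride [base], the
    input length, because [m] is still growing while the matrix is filled. *)
Definition reach_prog : cmd := (
  Asg vF (Cst 0) ;; Asg vRow (Cst 0) ;;
  For vW vM (
    IfZ (Minus (Var vI) (Arr aRank (Var vW)))
      (Asg vF (Plus (Var vF) (Arr aMat (Plus (Var vRow) (Var vT))))) Skip ;;
    Asg vRow (Plus (Var vRow) Base)))%cmd.

Definition level_prog : cmd := (
  Asg vCnt (Cst 0) ;;
  For vT vM (
    IfZ (Minus (Arr aRank (Var vT)) (Var vI))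
      (reach_prog ;; IfZ (Var vF) Skip (incr vCnt)) Skip))%cmd.

(** Cell 0 of the input is the number of slots. With truncated subtraction the sum vanishes iff no
    level exceeds it. *)
Definition excess_prog : cmd := (
  Asg vBad (Cst 0) ;;
  For vI vM (
    level_prog ;;
    Asg vBad (Plus (Var vBad) (Minus (Var vCnt) (Mem (Cst 0))))))%cmd.

(* The ranks are the digits in base [m] of a number to which this adds 1. *)
Definition next_prog : cmd := (
  Asg vCarry (Cst 1) ;;
  For vJ vM (
    IfZ (Var vCarry) Skip (
      IfZ (Minus (Minus (Var vM) (Cst 1)) (Arr aRank (Var vJ)))
        (Sto aRank (Var vJ) (Cst 0))
        (Sto aRank (Var vJ) (Plus (Arr aRank (Var vJ)) (Cst 1)) ;;
         Asg vCarry (Cst 0)))))%cmd.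

Definition try_prog : cmd := (
  excess_prog ;; IfZ (Var vBad) (Asg vAns (Cst 1)) Skip ;; next_prog)%cmd.

Definition search_prog : cmd := For vC vN try_prog.

(** Computes [m ^ m] by repeated addition, in quadratic time. *)
Definition power_prog : cmd := (
  Asg vN (Cst 1) ;;
  For vU vM (
    Asg vTmp (Cst 0) ;;
    For vV vM (Asg vTmp (Plus (Var vTmp) (Var vN))) ;;
    Asg vN (Var vTmp)))%cmd.

(** Pallets are numbered below [m], and [le] is the 0/1 matrix of the relation [w -> t]. *)
Definition reach (le : nat -> nat -> nat) (r : nat -> nat) m i t :=
  \sum_(w < m) (i <= r w) * le w t.

Definition level le (r : nat -> nat) m i :=
  \sum_(t < m) ((r t <= i) && (0 < reach le r m i t)).

Definition excess le r m p := \sum_(i < m) (level le r m i - p).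

Definition digit m v j := v %/ m ^ j %% m.

(** * Correctness of the search *)

Section Search.
Variables (base : nat) (inp : nat -> nat).
Local Notation run := (run base inp).

Lemma reach_progP s : va (run reach_prog s) vF =
  reach (fun w t => ar s aMat (w * base + t)) (ar s aRank) (va s vM) (va s vI) (va s vT).
Proof.
set g := fun w t => _.
pose Inv i s' := va s' vF = reach g (ar s aRank) i (va s vI) (va s vT)
  /\ va s' vRow = i * base.
suff: Inv (va s vM) (run reach_prog s) by case.
rewrite /reach_prog !run_seq.
apply: (for_inv (Inv := Inv)) => [|i s' [/= lti ci fv fa] [vf vr]].
  by split; rewrite // /reach big_ord0.
have [eI eT] : va s' vI = va s vI /\ va s' vT = va s vT by rewrite !fv.
rewrite /Inv; move: vf; rewrite /reach big_ord_recr /= => <-; rewrite ci eI eT !fa //.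
rewrite subn_eq0; case: leqP => _ /=.
  by rewrite mul1n vr mulSn [base + _]addnC.
by rewrite mul0n addn0 vr mulSn [base + _]addnC.
Qed.

Lemma level_progP s : va (run level_prog s) vCnt =
  level (fun w t => ar s aMat (w * base + t)) (ar s aRank) (va s vM) (va s vI).
Proof.
set g := fun w t => _.
pose Inv i s' := va s' vCnt =
  \sum_(t < i) ((ar s aRank t <= va s vI) && (0 < reach g (ar s aRank) (va s vM) (va s vI) t)).
rewrite /level_prog run_seq.
apply: (for_inv (Inv := Inv)) => [|i s' [lti ci fv fa] cnt].
  by rewrite /Inv big_ord0.
rewrite /= in fv fa; have [eI eM] : va s' vI = va s vI /\ va s' vM = va s vM by rewrite !fv.
rewrite run_if run_seq; have := reach_progP s'; rewrite eI eM ci !fa // -/g.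
have : va (run reach_prog s') vCnt = va s' vCnt by rewrite va_run.
move: (run reach_prog s') => s2 c2 f2.
rewrite /Inv big_ord_recr /= -cnt eI ci fa // subn_eq0 f2.
case: (_ <= va s vI) => /=; last by rewrite addn0.
by rewrite lt0n; case: eqP => _ /=; rewrite c2 ?addn0.
Qed.

Lemma excess_progP s : 0 < base -> va (run excess_prog s) vBad =
  excess (fun w t => ar s aMat (w * base + t)) (ar s aRank) (va s vM) (inp 0).
Proof.
move=> base0; set g := fun w t => _.
pose Inv i s' := va s' vBad =
  \sum_(j < i) (level g (ar s aRank) (va s vM) j - inp 0).
rewrite /excess_prog run_seq.
apply: (for_inv (Inv := Inv)) => [|i s' [lti ci fv fa] bad].
  by rewrite /Inv big_ord0.
rewrite /= in fv fa; have eM : va s' vM = va s vM by rewrite !fv.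
rewrite run_seq; have := level_progP s'; rewrite eM ci !fa // -/g.
have : va (run level_prog s') vBad = va s' vBad by rewrite va_run.
move: (run level_prog s') => s2 b2 c2.
by rewrite /Inv big_ord_recr /= -bad c2 b2 /mem base0.
Qed.

Lemma next_progP s v : (forall j, j < va s vM -> ar s aRank j = digit (va s vM) v j) ->
  forall j, j < va s vM ->
    ar (run next_prog s) aRank j = digit (va s vM) v.+1 j.
Proof.
set m := va s vM => rs.
(* Adding 1 to [v] produces a carry into digit [i] exactly when [m ^ i] divides [v.+1]. *)
pose Inv i s' := va s' vCarry = (m ^ i %| v.+1) /\ forall j, j < m ->
  ar s' aRank j = if j < i then digit m v.+1 j else digit m v j.
suff: Inv m (run next_prog s) by case=> _ r j ltj; rewrite r ?ltj.
rewrite /next_prog run_seq; apply: (for_inv (Inv := Inv)).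
  by split=> [|j ltj] /=; rewrite ?expn0 ?dvd1n ?rs.
move=> i s' [lti ci fv fa] [cy r].
have eM : va s' vM = m by rewrite fv.
have m0 : 0 < m by apply: leq_trans lti.
have mi0 : 0 < m ^ i by rewrite expn_gt0 m0.
have dS : digit m v.+1 i = if m ^ i %| v.+1 then (digit m v i).+1 %% m else digit m v i.
  rewrite /digit divnS //; case: ifP => _; rewrite ?add0n //.
  by rewrite add1n -[in RHS]addn1 modnDml addn1.
have dvS : (m ^ i.+1 %| v.+1) = (m ^ i %| v.+1) && ((digit m v i).+1 %% m == 0).
  case: (boolP (m ^ i %| v.+1)) => [|nd] /=; last first.
    by apply/negP=> /(dvdn_trans _) d; case/negP: nd; apply: d; rewrite expnS dvdn_mull.
  move=> dv; rewrite expnS -dvdn_divRL // divnS // dv.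
  by rewrite /dvdn /digit -addn1 modnDml addn1.
have eq_r (w : nat) j : (if j < i.+1 then digit m v.+1 j else digit m v j) =
    if j == i then digit m v.+1 i else if j < i then digit m v.+1 j else digit m v j.
  by rewrite ltnS leq_eqVlt; case: eqP => [->|].
rewrite /Inv /= cy; case: (boolP (m ^ i %| v.+1)) => dv /=; last first.
  rewrite cy (negPf dv) dvS (negPf dv); split=> // j ltj; rewrite r // eq_r //.
  by case: eqP => [->|//]; rewrite ltnn dS (negPf dv).
rewrite eM ci r // ltnn dvS dv /= subn_eq0.
have ltd : digit m v i < m by rewrite ltn_mod.
have [gem|ltm] := leqP (m - 1) (digit m v i); rewrite /= ?cy.
  have dE : (digit m v i).+1 = m by lia.
  rewrite dE modnn dv; split=> // j ltj; rewrite eq_r // r // dS dv dE modnn.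
  by case: eqP.
have -> : (digit m v i).+1 %% m = (digit m v i).+1 by rewrite modn_small; lia.
split=> // j ltj; rewrite eq_r // r // dS dv modn_small ?addn1; last by lia.
by case: eqP.
Qed.

Lemma excess_eq g g' r r' m p : (forall w t, w < m -> t < m -> g w t = g' w t) ->
  (forall j, j < m -> r j = r' j) -> excess g r m p = excess g' r' m p.
Proof.
move=> eg er; apply: eq_bigr => i _; congr (_ - _); apply: eq_bigr => t _.
rewrite er //; congr (nat_of_bool (_ && (_ < _))).
by apply: eq_bigr => w _; rewrite er ?eg.
Qed.

Lemma search_progP s g : 0 < base -> va s vAns = 0 ->
  (forall w t, w < va s vM -> t < va s vM -> ar s aMat (w * base + t) = g w t) ->
  (forall j, j < va s vM -> ar s aRank j = 0) ->
  va (run search_prog s) vAns =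
  has (fun v => excess g (digit (va s vM) v) (va s vM) (inp 0) == 0) (iota 0 (va s vN)).
Proof.
set m := va s vM => base0 ans0 sg r0.
(* Before round [i] the numbers below [i] have been tried and the rank array spells [i] in base
   [m]. *)
pose Inv i s' := va s' vAns =
    has (fun v => excess g (digit m v) m (inp 0) == 0) (iota 0 i)
  /\ forall j, j < m -> ar s' aRank j = digit m i j.
suff: Inv (va s vN) (run search_prog s) by case.
apply: (for_inv (Inv := Inv)) => [|i s' [lti ci fv fa] [ans r]].
  by split=> //= j ltj; rewrite r0 // /digit div0n mod0n.
have eM : va s' vM = m by rewrite fv.
have eA : ar s' aMat = ar s aMat by rewrite fa.
rewrite 2!run_seq; have := excess_progP s' base0.
have eR : ar (run excess_prog s') aRank = ar s' aRank by rewrite ar_run.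
have eS : va (run excess_prog s') vAns = va s' vAns by rewrite va_run.
have eN : va (run excess_prog s') vM = m by rewrite va_run.
move: (run excess_prog s') eR eS eN => s2 eR eS eN.
rewrite eM (@excess_eq _ g _ (digit m i)) => [bad|w t ltw ltt|//]; last by rewrite eA sg.
pose s3 := run (IfZ (Var vBad) (Asg vAns (Cst 1)) Skip) s2.
have eN3 : va s3 vM = m by rewrite /s3 /=; case: eqP.
have eR3 : ar s3 aRank = ar s' aRank by rewrite /s3 /=; case: eqP.
have := @next_progP s3 i; rewrite eN3 eR3 => /(_ r) r3.
have eA3 : va (run next_prog s3) vAns = va s3 vAns by rewrite va_run.
rewrite -/s3; move: (run next_prog s3) r3 eA3 => s4 r4 eA4; split=> //.
rewrite -[va _ _]/(va s4 vAns) eA4 -addn1 iotaD has_cat /= add0n orbF.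
by rewrite /s3 /= bad; case: eqP => _ /=; rewrite ?orbT ?orbF // eS.
Qed.

Lemma power_progP s : va (run power_prog s) vN = va s vM ^ va s vM.
Proof.
set m := va s vM.
pose Inv i s' := va s' vN = m ^ i.
rewrite /power_prog run_seq.
apply: (for_inv (Inv := Inv)) => [|i s' [lti ci fv fa] en]; first by rewrite /Inv expn0.
have eM : va s' vM = m by rewrite fv.
rewrite !run_seq; set s2 := run (Asg vTmp _) s'.
pose Inv2 j s'' := va s'' vTmp = j * m ^ i.
have : Inv2 (va s2 vM) (run (For vV vM (Asg vTmp (Plus (Var vTmp) (Var vN)))) s2).
  apply: (for_inv (Inv := Inv2)) => [//|j s'' [_ _ fv2 _] t].
  by rewrite /Inv2 /= t fv2 //= en mulSn addnC.
rewrite /Inv2; move: (run (For _ _ _) s2) => s3 e3.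
by rewrite /Inv /= e3 /= eM expnS.
Qed.

End Search.

(** * Reading the queues *)

(* [aFirst] and [aLast] hold addresses of bins.  Those below [vS] are left from
   earlier queues, and 0 means that the pallet has not been seen at all. *)
Definition enter_prog : cmd := (
  Asg vX (Mem (Var vA)) ;;
  IfZ (Arr aLast (Var vX)) (Sto aPal (Var vM) (Var vX) ;; incr vM) Skip)%cmd.

Definition mark_prog : cmd := (
  IfZ (Minus (Var vS) (Arr aFirst (Var vX))) Skip
    (Sto aFirst (Var vX) (Var vA)) ;;
  Sto aLast (Var vX) (Var vA) ;;
  incr vA)%cmd.

(** Zero iff both truncated differences are: the first mark of [u] is not stale, so [u] occurs in
    the current queue, and the last mark of [v] is not before it. *)
Definition arc_exp := 
  let f := Arr aFirst (Arr aPal (Var vU)) in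
  Plus (Minus (Var vS) f) (Minus f (Arr aLast (Arr aPal (Var vV)))).

Definition arcs_prog : cmd := (
  Asg vRow (Cst 0) ;;
  For vU vM (
    For vV vM (IfZ arc_exp (Sto aMat (Plus (Var vRow) (Var vV)) (Cst 1)) Skip) ;;
    Asg vRow (Plus (Var vRow) Base)))%cmd.

Definition open_prog : cmd := (
  Asg vLen (Mem (Var vA)) ;; incr vA ;; Asg vS (Var vA))%cmd.

Definition scan_prog : cmd := For vB vLen (enter_prog ;; mark_prog)%cmd.

Definition queue_prog : cmd := (open_prog ;; scan_prog ;; arcs_prog)%cmd.

Definition read_prog : cmd := (
  Asg vK (Mem (Cst 1)) ;; Asg vA (Cst 2) ;; For vQ vK queue_prog)%cmd.

(** The share of one queue in the relation [x -> y]. For [x] absent from [q], [index] is the size of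
    [q] and the remainder is empty. *)
Definition precedes (q : seq nat) x y := y \in drop (index x q) q.
Definition arc (Q : seq (seq nat)) x y := has (fun q => precedes q x y) Q.

Definition cells (Q : seq (seq nat)) := flatten [seq size q :: q | q <- Q].

Lemma flat_index_inj b u v u' v' : v < b -> v' < b ->
  (u * b + v == u' * b + v') = (u == u') && (v == v').
Proof.
move=> ltv ltv'; apply/eqP/andP => [e|[/eqP-> /eqP->] //].
have b0 : 0 < b by apply: leq_ltn_trans ltv.
have := congr1 (divn^~ b) e; have := congr1 (modn^~ b) e.
by rewrite !modnMDl !modn_small // !divnMDl // !divn_small // !addn0 => -> ->.
Qed.

Definition queue_cost a m := bound open_prog 0
  + (3 + a * (bound (enter_prog ;; mark_prog)%cmd 0 + 5)) + bound arcs_prog m.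

(** * Correctness of the scan *)

Section Scan.
Variables (p : nat) (Q : seq (seq nat)).
Let enc := [:: p, size Q & cells Q].
Let base := size enc.
Let inp := nth 0 enc.
Local Notation run := (run base inp).

Definition addr i := 2 + size (cells (take i Q)).

Lemma cells_cat Q1 Q2 : cells (Q1 ++ Q2) = cells Q1 ++ cells Q2.
Proof. by rewrite /cells map_cat flatten_cat. Qed.

Lemma cellsE i : i < size Q ->
  cells Q = cells (take i Q) ++ size (nth [::] Q i) :: nth [::] Q i ++ cells (drop i.+1 Q).
Proof.
by move=> lti; rewrite -{1}(cat_take_drop i Q) cells_cat (drop_nth [::] lti).
Qed.

Lemma addrS i : i < size Q -> addr i.+1 = (addr i).+1 + size (nth [::] Q i).
Proof.
move=> lti; rewrite /addr (take_nth [::] lti) -cats1 cells_cat size_cat.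
by rewrite /cells /= cats0 /=; lia.
Qed.

Lemma addr_base i : i < size Q -> (addr i).+1 + size (nth [::] Q i) <= base.
Proof.
move=> lti; rewrite /base /enc /= (cellsE lti) size_cat /= size_cat /addr; lia.
Qed.

Lemma inp_addr i : i < size Q -> inp (addr i) = size (nth [::] Q i).
Proof.
move=> lti; rewrite /inp /enc /addr add2n /= (cellsE lti).
by rewrite nth_cat ltnn subnn.
Qed.

Lemma inp_bin i b : i < size Q -> b < size (nth [::] Q i) ->
  inp ((addr i).+1 + b) = nth 0 (nth [::] Q i) b.
Proof.
move=> lti ltb; rewrite /inp /enc /addr add2n !addSn /= (cellsE lti).
by rewrite -addnS nth_cat ltnNge leq_addr /= addKn /= nth_cat ltb.
Qed.

Definition pal_inv s (ps : seq nat) :=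
  [/\ uniq ps, va s vM = size ps, forall j, j < size ps -> ar s aPal j = nth 0 ps j
    & forall x, (ar s aLast x == 0) = (x \notin ps)].

(** Here [q] is the scanned part of a queue whose bins start at address [st]. The last clause
    characterises the last occurrence by all its lower bounds; [i = 0] covers symbols that do not
    occur. *)
Definition mark_inv s st (q : seq nat) :=
  [/\ forall x, x \in q -> ar s aFirst x = st + index x q,
      forall x, x \notin q -> ar s aFirst x < st
    & forall x i, (st + i <= ar s aLast x) = (x \in drop i q)].

(** Cells outside the known pallets are required to be 0, so that rows and columns of pallets
    discovered later start out clean. *)
Definition mat_inv s (ps : seq nat) done := forall u v, u < base -> v < base ->
  ar s aMat (u * base + v) =
  [&& u < size ps, v < size ps & arc done (nth 0 ps u) (nth 0 ps v)].

Lemma enter_progP s (ps : seq nat) x : pal_inv s ps -> mem base inp s (va s vA) = x ->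
  va (run enter_prog s) vX = x /\
  exists2 ext : seq nat, ps ++ ext =i rcons ps x & 
   [/\ uniq (ps ++ ext), va (run enter_prog s) vM = size (ps ++ ext)
    & forall j, j < size (ps ++ ext) -> ar (run enter_prog s) aPal j = nth 0 (ps ++ ext) j].
Proof.
move=> [ups eM eP eL] ex; rewrite /= ex eL; split; first by case: ifP.
case: (boolP (x \in ps)) => xps /=.
  exists [::]; rewrite cats0 //.
  by move=> z; rewrite mem_rcons inE; case: eqP => // ->.
exists [:: x]; first by move=> z; rewrite cats1.
rewrite cats1 rcons_uniq xps size_rcons eM addn1; split=> // j ltj.
rewrite nth_rcons; case: eqP => [->|neq]; first by rewrite ltnn.
have ltj' : j < size ps by lia.
by rewrite ltj' eP.
Qed.

Lemma mark_progP s st q : mark_inv s st q -> va s vS = st -> va s vA = st + size q ->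
  mark_inv (run mark_prog s) st (rcons q (va s vX)).
Proof.
move=> [f1 f2 l] eS eA; set x := va s vX.
have eL : ar (run mark_prog s) aLast = upd (ar s aLast) x (st + size q).
  by rewrite /= -eA; case: ifP.
have eF : ar (run mark_prog s) aFirst =
    if x \in q then ar s aFirst else upd (ar s aFirst) x (st + size q).
  rewrite /= eS -/x -eA subn_eq0.
  case: (boolP (x \in q)) => xq; first by rewrite f1 // leq_addr.
  by rewrite leqNgt f2.
rewrite /mark_inv eL eF; split=> [z|z|z i] /=.
- rewrite mem_rcons inE -cats1 index_cat; case: (boolP (x \in q)) => xq.
    case: (boolP (z \in q)) => zq; first by rewrite f1.
    by rewrite orbF => /eqP zx; rewrite zx xq in zq.
  case: (boolP (z \in q)) => zq; last by rewrite orbF => /eqP->; rewrite /= !eqxx addn0.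
  by rewrite /upd; case: eqP => [zx|_]; [rewrite zx (negPf xq) in zq|rewrite f1].
- rewrite mem_rcons inE negb_or => /andP[zx zq].
  by case: ifP => _; rewrite ?/upd ?(negPf zx) f2.
- have [lei|lti] := leqP i (size q).
    rewrite -cats1 drop_cat; have [lt|ge] := ltnP i (size q).
      rewrite mem_cat inE -l; case: eqP => [->|_]; last by rewrite orbF.
      by rewrite orbT leq_add2l ltnW.
    have -> : i = size q by lia.
    rewrite subnn drop0 inE; case: eqP => [_|_]; first by rewrite leqnn.
    by rewrite l drop_size.
  rewrite drop_oversize ?size_rcons //; case: eqP => [_|_].
    by rewrite in_nil leq_add2l leqNgt lti.
  by rewrite l drop_oversize // ltnW.
Qed.

Lemma scan_progP s (q : seq nat) st (ps : seq nat) :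
  pal_inv s ps -> va s vA = st -> va s vS = st ->
  va s vLen = size q -> 0 < st -> st + size q <= base ->
  (forall b, b < size q -> inp (st + b) = nth 0 q b) -> mark_inv s st [::] ->
  let s' := run scan_prog s in
  exists2 ext : seq nat, ps ++ ext =i ps ++ q &
  [/\ pal_inv s' (ps ++ ext), va s' vA = st + size q & mark_inv s' st q].
Proof.
move=> P0 eA eS eLen st0 leb eq mk.
pose Inv b s' := exists2 ext : seq nat, ps ++ ext =i ps ++ take b q &
  [/\ pal_inv s' (ps ++ ext), va s' vA = st + b & mark_inv s' st (take b q)].
suff: Inv (va s vLen) (run scan_prog s) by rewrite eLen /Inv take_size.
apply: (for_inv (Inv := Inv)) => [|b s' [ltb cb fv fa] [ext eext [P1 eA1 mk1]]].
  by exists [::]; rewrite take0 cats0 ?addn0.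
rewrite eLen in ltb; rewrite /= in fv.
have eS1 : va s' vS = st by rewrite fv.
have [|eX [ext2 eext2 [U2 M2 P2]]] := @enter_progP s' (ps ++ ext) (nth 0 q b) P1.
  by rewrite eA1 /mem (leq_trans _ leb) ?ltn_add2l ?eq.
have [_ _ _ L1] := P1.
rewrite run_seq; have frv x : x \notin [:: vX; vM] -> va (run enter_prog s') x = va s' x.
  by move=> nx; rewrite va_run.
have fra x : x != aPal -> ar (run enter_prog s') x = ar s' x.
  by move=> nx; rewrite ar_run // inE.
move: (run enter_prog s') eX M2 P2 frv fra => s2 eX M2 P2 frv fra.
have mk2 : mark_inv s2 st (take b q) by rewrite /mark_inv !fra.
have sz : size (take b q) = b by rewrite size_take_min; lia.
have := mark_progP mk2; rewrite (frv vS) // (frv vA) // eS1 eA1 sz => /(_ erefl erefl).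
have eM3 : va (run mark_prog s2) vM = va s2 vM by rewrite va_run.
have eP3 : ar (run mark_prog s2) aPal = ar s2 aPal by rewrite ar_run.
have eA3 : va (run mark_prog s2) vA = va s2 vA + 1 by rewrite /=; case: ifP.
have eL3 : ar (run mark_prog s2) aLast = upd (ar s2 aLast) (va s2 vX) (va s2 vA).
  by rewrite /=; case: ifP.
move: (run mark_prog s2) eM3 eP3 eA3 eL3 => s3 eM3 eP3 eA3 eL3.
rewrite eX -take_nth // => mk3.
exists (ext ++ ext2).
  move=> z; rewrite catA eext2 mem_rcons inE eext (take_nth 0 ltb) !mem_cat mem_rcons inE.
  by rewrite orbCA.
rewrite catA; split=> //; last by rewrite /= eA3 frv // eA1 addn1 addnS.
split=> //=; rewrite ?eM3 ?eP3 //.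
move=> x; rewrite eL3 eext2 mem_rcons inE eX frv // eA1 fra //=.
case: (x =P nth 0 q b) => [_|_] /=; last exact: L1.
(* Addresses of bins are positive, so a written mark differs from the value 0 for unseen pallets. *)
by apply/negbTE; rewrite -lt0n addn_gt0 st0.
Qed.

Lemma arcs_progP s ps q st done : pal_inv s ps -> size ps <= base ->
  va s vS = st -> mark_inv s st q -> mat_inv s ps done ->
  mat_inv (run arcs_prog s) ps (rcons done q).
Proof.
move=> [_ eM eP _] leb eS [f1 f2 l] mat.
have arcE x y : (st - ar s aFirst x + (ar s aFirst x - ar s aLast y) == 0) = precedes q x y.
  rewrite addn_eq0 !subn_eq0 /precedes; case: (boolP (x \in q)) => xq.
    by rewrite f1 // leq_addr l.
  by rewrite leqNgt f2 //= drop_oversize // memNindex.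
pose done_cell u v := arc done (nth 0 ps u) (nth 0 ps v).
pose new_cell u v := precedes q (nth 0 ps u) (nth 0 ps v).
(* The arcs of [q] have been entered in all rows before [n] and in the first [k] cells of row
   [n]. *)
pose Row n k s' := forall u v, u < base -> v < base -> ar s' aMat (u * base + v) =
  [&& u < size ps, v < size ps &
      done_cell u v || new_cell u v && ((u < n) || (u == n) && (v < k))].
pose Inv i s' := va s' vRow = i * base /\ Row i 0 s'.
suff: Inv (va s vM) (run arcs_prog s).
  case=> _ R u v ltu ltv; rewrite R // /arc has_rcons eM ltn0 andbF orbF.
  by case: (u < size ps) => //=; rewrite andbT orbC.
rewrite /arcs_prog run_seq.
apply: (for_inv (Inv := Inv)) => [|u s' [ltu cu fv fa] [eR RI]].
  by split=> // u v ltu ltv /=; rewrite mat // !ltn0 andbF /= andbF orbF.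
rewrite /= in ltu fv fa; rewrite eM in ltu.
have [eM1 eS1] : va s' vM = size ps /\ va s' vS = st by rewrite !fv.
rewrite run_seq; set loop := For _ _ _.
pose Inv2 k s'' := Row u k s''.
have : Inv2 (va s' vM) (run loop s').
  apply: (for_inv (Inv := Inv2)) => [|v s'' [ltv cv fv2 fa2] RI2].
    by move=> a b lta ltb; rewrite RI.
  rewrite /= in fv2 fa2; rewrite eM1 in ltv.
  have eU : va s'' vU = u by rewrite fv2.
  rewrite run_if /= fv2 // eS1 eU cv !fa2 // !fa // !eP // arcE.
  move=> a b lta ltb.
  have RE : ar (if precedes q (nth 0 ps u) (nth 0 ps v)
      then seta s'' aMat (va s'' vRow + v) 1 else s'') aMat (a * base + b) =
    if (a == u) && (b == v) && new_cell u v then 1 else ar s'' aMat (a * base + b).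
    rewrite -/(new_cell u v); case: (new_cell u v); rewrite ?andbF ?andbT //=.
    by rewrite fv2 // eR flat_index_inj // (leq_trans ltv).
  rewrite /= RE RI2 //; case: (altP (a =P u)) => [->|na] //=.
  case: (altP (b =P v)) => [->|nb] /=.
    rewrite ltu ltv ltnn /= ltnS leqnn ltnn /= andbT andbF orbF.
    by case: ifP => _; rewrite ?orbT ?orbF.
  by rewrite ltnS [b <= v]leq_eqVlt (negPf nb).
have eR3 : va (run loop s') vRow = va s' vRow by rewrite va_run.
rewrite /Inv2 eM1; move: (run loop s') eR3 => s3 eR3 R3; split.
  by rewrite /= eR3 eR mulSn addnC.
move=> a b lta ltb; rewrite /= R3 // ltn0 andbF orbF ltnS [a <= u]leq_eqVlt.
case: (a < size ps) => //=; case: (b < size ps) => //=.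
by rewrite andbT [(a < u) || _]orbC.
Qed.

(** The bins of queue [i] start at [(addr i).+1], so the last clause says that all old marks will be
    recognised as stale. *)
Definition queue_inv i s := exists2 ps : seq nat, ps =i flatten (take i Q) &
  [/\ pal_inv s ps, mat_inv s ps (take i Q), va s vA = addr i
    & forall x, ar s aFirst x <= addr i /\ ar s aLast x <= addr i].

Lemma size_cells Q' : size (cells Q') = size Q' + size (flatten Q').
Proof.
elim: Q' => // q Q' IH; rewrite -cat1s cells_cat flatten_cat !size_cat IH.
by rewrite /=; lia.
Qed.

Lemma size_pal (ps : seq nat) i : uniq ps -> ps =i flatten (take i Q) ->
  size ps <= size (undup (flatten Q)).
Proof.
move=> ups eps; apply: uniq_leq_size => // x; rewrite eps mem_undup.
by rewrite -{2}(cat_take_drop i Q) flatten_cat mem_cat => ->.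
Qed.

Lemma size_undup_base : size (undup (flatten Q)) <= base.
Proof.
apply: (leq_trans (size_undup _)); rewrite /base /= size_cells; lia.
Qed.

Lemma queue_progP i s : i < size Q -> queue_inv i s ->
  queue_inv i.+1 (run queue_prog s) /\
  cost base inp queue_prog s <=
  queue_cost (size (nth [::] Q i)) (size (undup (flatten Q))).
Proof.
move=> lti [ps eps [P mat eA le_addr]]; set q := nth [::] Q i.
have memA : mem base inp s (addr i) = size q.
  by rewrite /mem (leq_trans _ (addr_base lti)) ?inp_addr // ltnS leq_addr.
pose s1 := run open_prog s.
have [v1 [v2 v3]] : va s1 vLen = size q /\ va s1 vA = (addr i).+1 /\ va s1 vS = (addr i).+1.
  by rewrite /s1 /= eA memA addn1.
have v4 : va s1 vM = va s vM by [].
have a1 : ar s1 = ar s by [].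
have P1 : pal_inv s1 ps by [].
have M1 : mark_inv s1 (addr i).+1 [::].
  split=> [//|x _|x j]; rewrite ?in_nil a1 ?ltnS; have [le1 le2] := le_addr x => //.
  by apply/negbTE; rewrite -ltnNge; lia.
have inpq b : b < size q -> inp ((addr i).+1 + b) = nth 0 q b by exact: inp_bin.
have [ext eext [P2 eA2 M2]] := scan_progP P1 v2 v3 v1 (ltn0Sn _) (addr_base lti) inpq M1.
pose s2 := run scan_prog s1.
(* A pallet first met in queue [i] has no arc in earlier queues, so the zeros in its row and column
   are already correct. *)
have mat2 : mat_inv s2 (ps ++ ext) (take i Q).
  have subps x y : arc (take i Q) x y -> x \in ps /\ y \in ps.
    move=> /hasP[q' q'Q]; rewrite /precedes => yd; rewrite !eps.
    have yq := mem_drop yd.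
    have xq : x \in q'.
      by rewrite -index_mem ltnNge; apply: contraL yd => /drop_oversize->.
    by split; apply/flattenP; exists q'.
  have [ups _ _ _] := P2; rewrite cat_uniq in ups.
  have notps j : size ps <= j -> j < size (ps ++ ext) -> nth 0 (ps ++ ext) j \notin ps.
    move=> gej ltj; rewrite nth_cat ltnNge gej /=.
    case/and3P: ups => _ /hasPn h _; apply: h; rewrite mem_nth //.
    by rewrite ltn_subLR // -size_cat.
  move=> u v ltu ltv; have -> : ar s2 aMat = ar s aMat by rewrite /s2 ar_run.
  rewrite mat //; congr nat_of_bool.
  have [leu|gtu] := ltnP u (size ps); last first.
    apply/esym/negbTE/and3P => -[ltu' _ /subps[xin _]].
    by case/negP: (notps _ gtu ltu').
  have [lev|gtv] := ltnP v (size ps); last first.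
    apply/esym/negbTE/and3P => -[_ ltv' /subps[_ yin]].
    by case/negP: (notps _ gtv ltv').
  by rewrite !nth_cat leu lev size_cat !ltn_addr.
have eS2 : va s2 vS = (addr i).+1 by rewrite /s2 va_run.
have eflat : ps ++ ext =i flatten (take i.+1 Q).
  by move=> x; rewrite eext (take_nth [::] lti) flatten_rcons !mem_cat eps.
have lesz : size (ps ++ ext) <= size (undup (flatten Q)).
  by case: P2 => ups _ _ _; apply: size_pal eflat.
have mat3 := arcs_progP P2 (leq_trans lesz size_undup_base) eS2 M2 mat2.
split.
  exists (ps ++ ext) => //; rewrite 2!run_seq -/s1 -/s2; split.
  - by rewrite /pal_inv (va_run base inp s2) // !(ar_run base inp s2).
  - by rewrite (take_nth [::] lti).
  - by rewrite (va_run base inp s2) // eA2 addrS.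
  - move=> x; rewrite !(ar_run base inp s2) //; case: M2 => f1 f2 l; split.
      rewrite addrS // -/q; case: (boolP (x \in q)) => xq.
        by rewrite f1 // leq_add2l index_size.
      by rewrite ltnW // (leq_trans (f2 _ xq)) // leq_addr.
    rewrite addrS // -/q leqNgt -addnS l drop_oversize //.
rewrite -[cost _ _ _ _]/(cost base inp open_prog s +
  (cost base inp scan_prog s1 + cost base inp arcs_prog s2)) addnA.
apply: leq_add; first apply: leq_add.
(* There are no loops here, so any variable that is not written may stand for the loop bound. *)
- exact: (@cost_bound _ _ 99).
- have -> x : size q * x = \sum_(b < va s1 vLen) x.
    by rewrite sum_nat_const card_ord v1.
  apply: (for_cost_le (Inv := fun _ _ => True)
    (T := fun=> bound (enter_prog ;; mark_prog)%cmd 0)) => // b s' _ _.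
  exact: (@cost_bound _ _ 99).
- apply: leq_trans (@cost_bound _ _ vM _ _ _ _) _ => //; apply: bound_mono.
  by case: P2 => _ -> _ _.
Qed.

End Scan.

(** * Rankings and processings *)

Lemma mem_take_mono (T : eqType) (s : seq T) m n x :
  m <= n -> x \in take m s -> x \in take n s.
Proof. by move=> lemn; apply: mem_subseq; rewrite -(take_takel s lemn) take_subseq. Qed.

Lemma mem_drop_mono (T : eqType) (s : seq T) m n x :
  m <= n -> x \in drop n s -> x \in drop m s.
Proof. by move=> lemn; rewrite -(subnK lemn) -drop_drop => /mem_drop. Qed.

Lemma mem_take_find (T : eqType) (a : pred T) s x : x \in take (find a s) s -> ~~ a x.
Proof.
elim: s => //= y s IH; case: (boolP (a y)) => // nay.
by rewrite inE => /orP[/eqP->|/IH].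
Qed.

(** The witness is the entry at position [find a s]; this is its first occurrence, as earlier
    entries fail [a]. *)
Lemma mem_drop_find (a : pred nat) s x : x \in drop (find a s) s ->
  exists2 w, a w & precedes s w x.
Proof.
rewrite /precedes; elim: s => //= y s IH; case: (boolP (a y)) => ay.
  by move=> xs; exists y; rewrite ?eqxx.
case/IH=> w aw ws; exists w => //; case: eqP => // yw.
by rewrite yw aw in ay.
Qed.

Lemma precedes_mem s w x : precedes s w x -> w \in s.
Proof.
move=> ps; rewrite -index_mem ltnNge; apply: contraL ps => /drop_oversize.
by rewrite /precedes => ->.
Qed.

Section Stackable.
Variable I : fifo_instance.

Definition symbols : seq (seq nat) := [seq [seq plt b | b <- q] | q <- queues I].

(** The pallets that may be open during round [i] of the processing given by [r]. *)
Definition crowd (r : nat -> nat) i :=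
  count (fun t => (r t <= i) && has (fun w => (i <= r w) && arc symbols w t) (pallets I))
    (pallets I).

Let line (j : 'I_(nb_queues I)) := [seq plt b | b <- queue j].

Lemma line_symbols j : line j \in symbols.
Proof. by apply: map_f; apply: mem_nth. Qed.

Lemma symbols_line q : q \in symbols -> exists j, q = line j.
Proof.
case/mapP=> q' /(nthP [::])[j ltj <-] ->.
by exists (Ordinal ltj).
Qed.

Lemma mem_pallets t : (t \in pallets I) = (t \in flatten symbols).
Proof. by rewrite mem_undup map_flatten. Qed.

Lemma line_pallets j t : t \in line j -> t \in pallets I.
Proof.
by move=> tj; rewrite mem_pallets; apply/flattenP; exists (line j); rewrite ?line_symbols.
Qed.

Lemma is_openP (c : config I) t :
  reflect ((exists j, t \in take (c j) (line j)) /\ exists l, t \in drop (c l) (line l))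
    (is_open c t).
Proof.
apply: (iffP existsP) => [[j /existsP[l /andP[tj tl]]]|[[j tj] [l tl]]].
  by rewrite map_take in tj; rewrite map_drop in tl; split; [exists j|exists l].
by exists j; apply/existsP; exists l; rewrite map_take map_drop tj.
Qed.

Definition cle (c d : config I) := [forall j, c j <= d j].

Lemma cle_refl : reflexive cle.
Proof. by move=> c; apply/forallP. Qed.

Lemma cle_trans : transitive cle.
Proof.
move=> d c e /forallP cd /forallP de; apply/forallP => j.
exact: leq_trans (cd j) (de j).
Qed.

Lemma cstep_cle : subrel (@cstep I) cle.
Proof.
move=> c d /existsP[j /andP[_ /eqP->]]; apply/forallP => l; rewrite ffunE.
by case: ifP.
Qed.

(** The bins that separate [c] from [d] may be removed in any order; induction on their number. *)
Lemma path_between (c d : config I) : cle c d -> cle d (cfinal I) ->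
  exists s, [/\ path (@cstep I) c s, last c s = d
    & all (fun e => cle c e && cle e d) s].
Proof.
have [n] := ubnP (\sum_j (d j - c j)); elim: n c => // n IH c ltn cd df.
have [->|neq] := eqVneq c d; first by exists [::].
have [j ltj] : exists j, c j < d j.
  apply/existsP; apply: contraR neq; rewrite negb_exists => /forallP ge.
  apply/eqP/ffunP => j; apply/eqP; rewrite eqn_leq (forallP cd) /=.
  by rewrite leqNgt ge.
pose c1 : config I := [ffun l => if l == j then (c l).+1 else c l].
have st : cstep c c1.
  apply/existsP; exists j; rewrite eqxx andbT (leq_trans ltj) //.
  by have := forallP df j; rewrite ffunE.
have c1d : cle c1 d.
  by apply/forallP => l; rewrite ffunE; case: eqP => [->//|_]; apply: (forallP cd).
have [|s [ps ls as_]] := IH c1 _ c1d df.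
  rewrite -ltnS; apply: leq_trans ltn; rewrite ltnS.
  rewrite (bigD1 j) //= [ltnRHS](bigD1 j) //= ffunE eqxx -addSn leq_add //; first by lia.
  by apply: leq_sum => l /negPf nl; rewrite ffunE nl.
exists (c1 :: s); rewrite /= st ps ls c1d andbT (cstep_cle st).
split=> //; apply: sub_all as_ => e /andP[ce ->]; rewrite andbT.
exact: cle_trans (cstep_cle st) ce.
Qed.

(** The configuration before round [i]: each queue is stopped at its first bin of rank at least
    [i]. *)
Definition front (r : nat -> nat) i : config I :=
  [ffun j => find (fun t => i <= r t) (line j)].

(** A removed bin for [t] lies before the front [i.+1], so [t] has rank at most [i]. A remaining one
    lies behind the front [i] of its queue, and the bin at that front supplies [w]. *)
Lemma front_open r i (d : config I) : cle (front r i) d -> cle d (front r i.+1) ->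
  nb_open d <= crowd r i.
Proof.
move=> /forallP ld /forallP du; apply: sub_count => t.
case/is_openP=> -[j tj] [l tl]; apply/andP; split.
  have : t \in take (front r i.+1 j) (line j) by apply: mem_take_mono tj.
  by rewrite ffunE => /mem_take_find; rewrite -ltnNge ltnS.
have : t \in drop (front r i l) (line l) by apply: mem_drop_mono tl.
rewrite ffunE => /mem_drop_find[w iw wt]; apply/hasP; exists w.
  exact: line_pallets (precedes_mem wt).
by rewrite iw; apply/hasP; exists (line l); rewrite ?line_symbols.
Qed.

Lemma crowd_stackable r : {in pallets I, forall t, r t < nb_pallets I} ->
  (forall i, i < nb_pallets I -> crowd r i <= slots I) -> stackable I.
Proof.
move=> rm cr; pose ok (c : config I) := nb_open c <= slots I.
have front_final i : cle (front r i) (cfinal I).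
  by apply/forallP => j; rewrite !ffunE -(size_map (@plt I)) find_size.
have fpath i : i <= nb_pallets I -> exists s,
    [/\ path (@cstep I) (cstart I) s, last (cstart I) s = front r i & all ok s].
  elim: i => [_|i IH lti].
    exists [::]; split=> //; apply/ffunP => j; rewrite !ffunE.
    by case: (line j).
  have [s1 [p1 l1 ok1]] := IH (ltnW lti).
  have [|s2 [p2 l2 ok2]] := @path_between (front r i) (front r i.+1) _ (front_final _).
    by apply/forallP => j; rewrite !ffunE; apply: sub_find => t /ltnW.
  exists (s1 ++ s2); rewrite cat_path last_cat l1 p1 all_cat ok1; split=> //=.
  apply: sub_all ok2 => c /andP[cl cu].
  exact: leq_trans (front_open cl cu) (cr i lti).
have [s [ps ls oks]] := fpath _ (leqnn _).
exists s; rewrite /processing ?ps ?ls /=.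
  (* No rank reaches [nb_pallets I], so the last front is at the end of every queue. *)
  apply/eqP/ffunP => j; rewrite !ffunE -(size_map (@plt I)); apply/eqP.
  rewrite eqn_leq find_size leqNgt -has_find; apply/hasPn => t tj.
  by rewrite -ltnNge rm // (line_pallets tj).
rewrite oks andbT /nb_open (@eq_count _ _ pred0) ?count_pred0 // => t.
by apply/is_openP => -[[j]]; rewrite ffunE take0.
Qed.


Definition touched (c : config I) t := [exists j, t \in take (c j) (line j)].

Lemma cle_touched c d t : cle c d -> touched c t -> touched d t.
Proof.
move=> /forallP cd /existsP[j tj]; apply/existsP; exists j.
exact: mem_take_mono tj.
Qed.

Lemma count_line t : t \in pallets I -> 1 < \sum_j count_mem t (line j).
Proof.
rewrite mem_undup => /mapP[b bQ ->]; apply: leq_trans (plt_twice bQ) _.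
rewrite -(count_map (@plt I) (pred1 (plt b))) map_flatten -/symbols.
rewrite count_flatten sumnE !big_map (big_nth [::]) big_mkord.
by apply: leq_sum.
Qed.

(* The only place where a pallet carried by a single bin would matter: the step
   that removes the first bin of [t] must leave another one. *)
Lemma first_touch_open (c d : config I) t : cstep c d -> t \in pallets I ->
  ~~ touched c t -> touched d t -> is_open d t.
Proof.
move=> st tp nct dt; apply/is_openP; split; first exact/existsP.
apply/existsP; apply: contraT; rewrite negb_exists => /forallP nd.
have := count_line tp; rewrite ltnNge => /negP[].
case/existsP: st => j /andP[ltj /eqP dE].
apply: (@leq_trans (\sum_l (l == j))); last first.
  by rewrite (bigD1 j) //= eqxx big1 // => l /negPf->.
have nc l : t \notin take (c l) (line l).
  by apply: contra nct => tl; apply/existsP; exists l.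
apply: leq_sum => l _; have := nd l; rewrite dE ffunE; case: eqP => [->|_] ndl.
  have ltj' : c j < size (line j) by rewrite size_map.
  rewrite -(cat_take_drop (c j) (line j)) (drop_nth 0 ltj') count_cat /=.
  by rewrite (count_memPn (nc j)) (count_memPn ndl) addn0 add0n leq_b1.
by rewrite -(cat_take_drop (c l) (line l)) count_cat (count_memPn (nc l)) (count_memPn ndl).
Qed.

(** In the queue of the arc the first bin for [w] is still present in [c], hence so is a bin for [t]
    at or after it. If none for [t] remains there in [d], the step removed that first bin for [w]
    and it was the one for [t]; then [t = w] is touched for the first time. *)
Lemma step_open (c d : config I) t w : cstep c d -> t \in pallets I ->
  touched d t -> ~~ touched c w -> arc symbols w t -> is_open d t.
Proof.
move=> st tp dt ncw /hasP[q /symbols_line[l ->] wt].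
have wl : w \in line l := precedes_mem wt.
have lew : c l <= index w (line l).
  by rewrite leqNgt -in_take //; apply: contra ncw => wc; apply/existsP; exists l.
have [tdl|ndl] := boolP (t \in drop (d l) (line l)).
  by apply/is_openP; split; [exact/existsP|exists l].
suff tw : t = w by apply: first_touch_open st tp _ dt; rewrite tw.
have ltd : index w (line l) < d l.
  by rewrite ltnNge; apply: contra ndl => le; apply: mem_drop_mono le wt.
have eqw : index w (line l) = c l.
  apply/eqP; rewrite eqn_leq lew andbT; case/existsP: st ltd => j /andP[_ /eqP->].
  by rewrite ffunE; case: ifP => _; rewrite ?ltnS // => /ltnW.
have dE : d l = (c l).+1.
  case/existsP: st ltd => j /andP[_ /eqP->]; rewrite ffunE eqw.
  by case: ifP; rewrite ?ltnn.
move: wt; rewrite /precedes (drop_nth 0) ?index_mem // nth_index // inE eqw -dE.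
by rewrite (negPf ndl) orbF => /eqP.
Qed.

Lemma stackable_crowd : stackable I -> exists2 r : nat -> nat,
  {in pallets I, forall t, r t < nb_pallets I}
  & forall i, i < nb_pallets I -> crowd r i <= slots I.
Proof.
case=> s /andP[ps /eqP ls] oks; pose C := cstart I :: s.
pose tau t := find (touched^~ t) C.
have tauC t : t \in pallets I -> has (touched^~ t) C.
  move=> tp; apply/hasP; exists (cfinal I); first by rewrite -ls mem_last.
  move: tp; rewrite mem_pallets => /flattenP[q /symbols_line[j ->] tj].
  by apply/existsP; exists j; rewrite ffunE -(size_map (@plt I)) take_size.
have mono n n' t : n <= n' -> n' < size C ->
    touched (nth (cstart I) C n) t -> touched (nth (cstart I) C n') t.
  move=> le lt; apply: cle_touched.
  apply: (sorted_leq_nth cle_trans cle_refl) => //; last exact: leq_ltn_trans lt.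
  exact: sub_path cstep_cle _ _ ps.
have tau_touched t : t \in pallets I -> touched (nth (cstart I) C (tau t)) t.
  by move=> tp; apply: (nth_find _ (tauC t tp)).
(* Times of first touch may exceed [m]; positions in the list sorted by them are ranks below [m]
   that respect their order. *)
pose byt := sort (relpre tau leq) (pallets I).
have sbyt : sorted (relpre tau leq) byt.
  by apply: sort_sorted => x y; apply: leq_total.
have ubyt : uniq byt by rewrite sort_uniq undup_uniq.
have tau_nth i j : i <= j -> j < nb_pallets I -> tau (nth 0 byt i) <= tau (nth 0 byt j).
  move=> leij ltj; have tr : transitive (relpre tau leq) by move=> x y z; apply: leq_trans.
  have rf : reflexive (relpre tau leq) by move=> x; apply: leqnn.
  apply: (sorted_leq_nth tr rf 0 sbyt) => //; rewrite inE size_sort //.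
  exact: leq_ltn_trans ltj.
have tbyt t : t \in pallets I -> nth 0 byt (index t byt) = t.
  by move=> tp; rewrite nth_index // mem_sort.
have ltr t : t \in pallets I -> index t byt < nb_pallets I.
  by move=> tp; rewrite /nb_pallets -(size_sort (relpre tau leq)) index_mem mem_sort.
exists (index^~ byt) => // i lti.
set t0 := nth 0 byt i.
have t0p : t0 \in pallets I by rewrite -(mem_sort (relpre tau leq)) mem_nth ?size_sort.
have ltC : tau t0 < size C by rewrite -has_find tauC.
have tau0 : 0 < tau t0.
  rewrite lt0n; apply/eqP=> e; have := tau_touched _ t0p; rewrite e /=.
  by case/existsP=> j; rewrite ffunE take0.
(* Nothing is touched at time 0, so some step from [n] to [n.+1] first touches [t0]. Pallets of rank
   at most [i] are touched after it, those of rank at least [i] are untouched before it. *)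
have [n eqn] : exists n, tau t0 = n.+1 by exists (tau t0).-1; rewrite prednK.
apply: (@leq_trans (nb_open (nth (cstart I) C n.+1))); last first.
  by apply: (allP oks); rewrite mem_nth // -eqn.
rewrite /crowd /nb_open -!size_filter; apply: uniq_leq_size.
  by rewrite filter_uniq ?undup_uniq.
move=> t; rewrite !mem_filter => /andP[/andP[rt /hasP[w wp /andP[rw wt]]] tp].
rewrite tp andbT; apply: (@step_open (nth (cstart I) C n) _ t w) => //.
- by apply: (pathP (cstart I) ps); rewrite -ltnS -eqn.
- apply: mono (tau_touched _ tp); last by rewrite -eqn.
  by have := tau_nth _ _ rt lti; rewrite tbyt // -/t0 eqn.
- have := @before_find _ (cstart I) (touched^~ w) C n; rewrite -/(tau w) => -> //.
  by have := tau_nth _ _ rw (ltr _ wp); rewrite tbyt // -/t0 eqn.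
Qed.

End Stackable.

(** * The algorithm *)

Definition main_prog : cmd := (read_prog ;; power_prog ;; search_prog)%cmd.

Definition zero_store := Store (fun=> 0) (fun _ _ => 0).

(** The digit expansions of the numbers below [m ^ m] run through all rankings with values below
    [m]. *)
Definition answer (Q : seq (seq nat)) p (ps : seq nat) :=
  let m := size ps in
  has (fun v => excess (fun w t => arc Q (nth 0 ps w) (nth 0 ps t)) (digit m v) m p == 0)
    (iota 0 (m ^ m)).

(** * The program on an encoded input *)

Section Main.
Variables (p : nat) (Q : seq (seq nat)).
Let enc := [:: p, size Q & cells Q].
Let base := size enc.
Let inp := nth 0 enc.
Let m := size (undup (flatten Q)).
Local Notation run := (run base inp).
Local Notation cost := (cost base inp).

Lemma read_progP s1 : s1 = run read_prog zero_store ->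
  (exists2 ps : seq nat, ps =i flatten Q & pal_inv s1 ps /\ mat_inv p Q s1 ps Q) /\
  cost read_prog zero_store <= bound (Asg vK (Mem (Cst 1)) ;; Asg vA (Cst 2))%cmd 0
    + (3 + \sum_(i < size Q) (queue_cost (size (nth [::] Q i)) m + 5)).
Proof.
set s0 := run (Asg vA (Cst 2)) (run (Asg vK (Mem (Cst 1))) zero_store).
have eK : va s0 vK = size Q by [].
have inv0 : queue_inv p Q 0 (setv s0 vQ 0).
  by exists [::]; rewrite ?take0 //; split=> //; rewrite /addr take0.
have invS i s : for_frame vQ vK queue_prog s0 i s -> queue_inv p Q i s ->
    queue_inv p Q i.+1 (setv (run queue_prog s) vQ i.+1).
  by case=> lti _ _ _ inv; case: (queue_progP lti inv).
rewrite /read_prog 2!run_seq -/s0 => ->; split.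
  have := for_inv inv0 invS; rewrite eK /queue_inv take_size.
  by case=> ps eps [P M _ _]; exists ps.
rewrite -[cost _ _]/(cost (Asg vK (Mem (Cst 1))) zero_store + (cost (Asg vA (Cst 2))
  (run (Asg vK (Mem (Cst 1))) zero_store) + cost (For vQ vK queue_prog) s0)) addnA.
apply: leq_add; first by [].
rewrite -eK; apply: (for_cost_le (T := fun i => queue_cost (size (nth [::] Q i)) m)
  inv0 invS) => i s [lti _ _ _] inv.
by case: (queue_progP lti inv).
Qed.

Lemma main_progP : exists ps : seq nat, [/\ uniq ps, ps =i flatten Q,
    va (run main_prog zero_store) vAns = answer Q p ps
  & cost main_prog zero_store <=
    bound (Asg vK (Mem (Cst 1)) ;; Asg vA (Cst 2))%cmd 0
    + (3 + \sum_(i < size Q) (queue_cost (size (nth [::] Q i)) m + 5))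
    + bound power_prog m + (3 + m ^ m * (bound try_prog m + 5))].
Proof.
pose s1 := run read_prog zero_store; pose s2 := run power_prog s1.
have [[ps eps [P M]] c1] := read_progP (erefl s1).
have [ups eM _ _] := P.
have em : size ps = m.
  apply: perm_size; apply: uniq_perm => //; first exact: undup_uniq.
  by move=> x; rewrite mem_undup.
have lem : m <= base by apply: size_undup_base.
have eM2 : va s2 vM = m by rewrite /s2 va_run // eM em.
have eN2 : va s2 vN = m ^ m by rewrite /s2 power_progP eM em.
have eR2 j : ar s2 aRank j = 0 by rewrite /s2 ar_run // /s1 ar_run.
have eA2 : va s2 vAns = 0 by rewrite /s2 va_run // /s1 va_run.
pose g w t : nat := arc Q (nth 0 ps w) (nth 0 ps t).
have eG2 w t : w < va s2 vM -> t < va s2 vM -> ar s2 aMat (w * base + t) = g w t.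
  rewrite eM2 => ltw ltt; rewrite /s2 ar_run // M ?em ?ltw ?ltt //.
    exact: leq_trans lem.
  exact: leq_trans lem.
exists ps; split=> //.
  rewrite /main_prog 2!run_seq -/s1 -/s2 (@search_progP _ _ _ g) //.
  by rewrite eM2 eN2 /answer em.
rewrite -[cost _ _]/(cost read_prog zero_store + (cost power_prog s1 + cost search_prog s2)).
rewrite addnA; apply: leq_add; first apply: leq_add c1 _.
  by apply: leq_trans (@cost_bound _ _ vM _ _ _ _) _ => //; rewrite eM em.
have -> x : m ^ m * x = \sum_(b < va s2 vN) x by rewrite sum_nat_const card_ord eN2.
apply: (for_cost_le (Inv := fun _ _ => True)
  (T := fun=> bound try_prog m)) => // v s' [_ _ fv _] _.
by rewrite -eM2 -fv //; apply: cost_bound.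
Qed.

(** Finds the end of the input, where the arrays begin, by hopping from one length cell to the next:
    register 1 is the address, 3 the number of queues left, 5 the constant 1. Only odd registers are
    used, so all variables are still 0 afterwards. *)
Definition prologue : program :=
  [:: SetC 5 1; Read 3 5; SetC 1 2; JumpZ 3 9; Defs.Sub 3 3 5; Read 7 1;
      Add 1 1 7; Add 1 1 5; Jump 3].

Lemma prologueP P' : exists R,
  steps (prologue ++ P') (init_state enc) (size Q * 6 + 4) (State 9 R inp) /\
  sim base inp zero_store R inp.
Proof.
have loop i : i <= size Q -> exists R,
    steps (prologue ++ P') (init_state enc) (3 + i * 6) (State 3 R inp) /\
    [/\ R 1 = addr Q i, R 3 = size Q - i, R 5 = 1 & forall x, R x.*2 = 0].
  elim: i => [_|i IH lti].
    eexists; split; first by do 3!(apply: StepsS; first by []); exact: Steps0.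
    split=> /=; [by rewrite /addr take0|by rewrite subn0|by []|].
    move=> x; do 3!(case: eqP => [xE|_]; first by have := odd_double x; rewrite xE).
    by [].
  have [R [st [e1 e3 e5 ev]]] := IH (ltnW lti).
  eexists; split.
    rewrite mulSn addnCA addnC; apply: (steps_trans st).
    apply: StepsS; first by []. rewrite /= ifN; last by rewrite e3; lia.
    by do 5!(apply: StepsS; first by []); exact: Steps0.
  split=> /=.
  - have -> : inp (R 1) = size (nth [::] Q i) by rewrite e1; apply: inp_addr.
    by rewrite e1 e5 addrS // addn1 addSn.
  - by rewrite e3 e5 subn1 subnS.
  - by [].
  - by move=> x; rewrite !ifN ?ev //; apply/eqP=> xE; have := odd_double x; rewrite xE.
have [R [st [e1 e3 _ ev]]] := loop _ (leqnn _).
exists R; split.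
  rewrite (_ : _ * 6 + 4 = 3 + size Q * 6 + 1); last by lia.
  apply: (steps_trans st); apply: StepsS; first by [].
  by rewrite /= e3 subnn; exact: Steps0.
split=> // [|i]; first by rewrite e1 /addr take_size.
by rewrite /mem; case: ltnP => // le; rewrite /inp nth_default.
Qed.

End Main.

(** * Rankings as numbers *)

Lemma digits_surj b n (r : nat -> nat) : (forall j, j < n -> r j < b) ->
  exists2 v, v < b ^ n & forall j, j < n -> digit b v j = r j.
Proof.
elim: n r => [|n IH] r ltr; first by exists 0.
have [j ltj|v ltv dv] := IH (fun j => r j.+1); first exact: ltr.
have r0 := ltr 0 (ltn0Sn n); have b0 : 0 < b by apply: leq_ltn_trans r0.
exists (v * b + r 0); first by rewrite expnS; nia.
case=> [_|j ltj]; first by rewrite /digit divn1 modnMDl modn_small.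
by rewrite /digit expnS divnMA divnMDl // (divn_small r0) addn0; apply: dv.
Qed.

(** As [ps] is a permutation of the pallets, sums over its positions count pallets, and [reach] is
    positive iff one of its 0/1 terms is 1. *)
Lemma level_crowd I (ps : seq nat) r r' i : uniq ps -> ps =i pallets I ->
  (forall j, j < size ps -> r' (nth 0 ps j) = r j) ->
  level (fun w t => arc (symbols I) (nth 0 ps w) (nth 0 ps t)) r (size ps) i = crowd I r' i.
Proof.
move=> ups eps er; rewrite /crowd.
have /permP <- : perm_eq ps (pallets I) by rewrite uniq_perm ?undup_uniq.
rewrite -sum1_count big_mkcond (big_nth 0) big_mkord; apply: eq_bigr => t _.
rewrite er // -(eq_has_r eps); set h := has _ _; set q := 0 < _.
suff -> : q = h by case: (_ && _).
rewrite /q lt0n /reach sum_nat_eq0 negb_forall.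
apply/existsP/hasP => [[w]|[x xps /andP[ix ax]]].
  rewrite /= muln_eq0 negb_or !eqb0 !negbK => /andP[iw aw].
  by exists (nth 0 ps w); rewrite ?mem_nth // er ?iw.
have ltx : index x ps < size ps by rewrite index_mem.
exists (Ordinal ltx) => /=; rewrite nth_index // ax -(er _ ltx) nth_index // ix.
by [].
Qed.

Lemma answerP I (ps : seq nat) : uniq ps -> ps =i pallets I ->
  reflect (stackable I) (answer (symbols I) (slots I) ps).
Proof.
move=> ups eps; have em : size ps = nb_pallets I.
  by apply: perm_size; rewrite uniq_perm ?undup_uniq.
have excess0 r r' : (forall j, j < size ps -> r' (nth 0 ps j) = r j) ->
    excess (fun w t => arc (symbols I) (nth 0 ps w) (nth 0 ps t)) r (size ps) (slots I) = 0
    <-> forall i, i < nb_pallets I -> crowd I r' i <= slots I.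
  move=> er; rewrite -em; split=> [/eqP|cr].
    rewrite sum_nat_eq0 => /forallP h i lti.
    by have := h (Ordinal lti); rewrite /= subn_eq0 (level_crowd _ _ _ er).
  by apply: big1 => i _; apply/eqP; rewrite subn_eq0 (level_crowd _ _ _ er) ?cr.
apply: (iffP hasP) => [[v _ /eqP ev]|/stackable_crowd[r rm cr]].
  pose r' t := digit (size ps) v (index t ps).
  apply: (@crowd_stackable I r') => [t tp|].
    (* A digit is below its base only if the base is positive; [t] itself shows that there is a
       pallet. *)
    rewrite -em ltn_mod em; apply: leq_ltn_trans (leq0n (index t (pallets I))) _.
    by rewrite index_mem.
  by apply: (excess0 _ _ _).1 ev => j ltj; rewrite /r' index_uniq.
have [j ltj|v ltv dv] := @digits_surj (size ps) (size ps) (fun j => r (nth 0 ps j)).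
  by rewrite em rm // -eps mem_nth.
exists v; first by rewrite mem_iota add0n.
by apply/eqP; apply: (excess0 _ r _).2 cr => j ltj; rewrite dv.
Qed.

Lemma encodeE I : encode I = [:: slots I, size (symbols I) & cells (symbols I)].
Proof.
rewrite /encode /cells /symbols size_map -map_comp; congr [:: _, _ & flatten _].
by apply: eq_map => q /=; rewrite size_map.
Qed.

(** * The time bound *)

Lemma sum_queue_cost (Q : seq (seq nat)) m :
  \sum_(i < size Q) (queue_cost (size (nth [::] Q i)) m + 5) =
  size Q * (bound open_prog 0 + 8 + bound arcs_prog m)
  + size (flatten Q) * (bound (enter_prog ;; mark_prog)%cmd 0 + 5).
Proof.
rewrite /queue_cost; move: (bound _ _) (bound (_ ;; _)%cmd _) (bound _ _) => a b c.
rewrite size_flatten /shape sumnE big_map (big_nth [::]) big_mkord big_distrl /=.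
rewrite -[X in X * _](card_ord (size Q)) -sum_nat_const -big_split /=.
by apply: eq_bigr => i _; lia.
Qed.

Lemma expn_leq_3 m : 0 < m -> m ^ m * m ^ 3 <= m ^ 2 * 3 ^ (m ^ 2).
Proof.
(* After cancelling [m ^ 2], this bounds [m ^ m.+1] by 3 to the power [(m - 1) * (m + 1)], and that
   exponent is below [m ^ 2]. *)
move=> m0; have lem n : n.+1 <= 3 ^ n by elim: n => // n IH; rewrite expnS; lia.
rewrite mulnC -expnD (_ : 3 + m = 2 + m.+1); last by lia.
rewrite expnD leq_mul2l; apply/orP; right.
apply: (@leq_trans ((3 ^ m.-1) ^ m.+1)).
  by rewrite leq_exp2r // -{1}(prednK m0).
by rewrite -expnM leq_pexp2l //; nia.
Qed.

(* [a .. f] stand for the constants of the program, [x] for the cost of the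
   search; every summand is at most a constant times the bracket. *)
Lemma time_bound a b c d e f k n m2 t x : 0 < m2 -> 0 < t -> x <= f * (m2 * t) ->
  k * 6 + 4 + (a + (3 + (k * (b + d * m2) + n * c)) + e * m2 + (3 + x)) <=
  (a + b + c + d + e + f + 16) * (m2 * t + n + k * m2).
Proof.
move=> m20 t0 lex; set S := (_ + n + _).
have S1 : m2 <= S by rewrite /S -addnA; apply: leq_trans (leq_addr _ _); rewrite leq_pmulr.
have S2 : k * m2 <= S by rewrite leq_addl.
have S3 : n <= S by rewrite /S; lia.
have S4 : m2 * t <= S by rewrite /S; lia.
have S5 : k <= S by apply: leq_trans S2; rewrite leq_pmulr.
have mul y z : z <= S -> y * z <= y * S by rewrite leq_mul2l orbC => ->.
have := mul a 1 (leq_trans m20 S1); have := mul 16 1 (leq_trans m20 S1).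
have := mul b _ S5; have := mul d _ S2; have := mul c _ S3; have := mul e _ S1.
have := mul f _ S4; have := mul 6 _ S5; have := mul 10 _ (leq_trans m20 S1).
rewrite !mulnDl mulnDr (mulnC n) (mulnCA k) (mulnC k b); lia.
Qed.

Theorem theorem18 :
  exists (P : program) (C : nat), forall I : fifo_instance,
    let k := nb_queues I in
    let n := nb_bins I in
    let m := nb_pallets I in
    exists2 t : nat, answers_in P (encode I) (stackable I) t
      & 0 < m -> t <= C * (m ^ 2 * 3 ^ (m ^ 2) + n + k * m ^ 2).
Proof.
(* The prologue has 9 instructions. The summands of the constant are [a], ..., [f] and 16 of
   [time_bound], in this order. *)
exists (prologue ++ compile 9 main_prog), (
  bound (Asg vK (Mem (Cst 1)) ;; Asg vA (Cst 2))%cmd 0 + (bound open_prog 0 + 8)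
  + (bound (enter_prog ;; mark_prog)%cmd 0 + 5) + bound arcs_prog 1
  + bound power_prog 1 + (bound try_prog 1 + 5) + 16) => I k n m.
pose Q := symbols I; pose enc := [:: slots I, size Q & cells Q].
have [ps [ups eps ans cst]] := main_progP (slots I) Q.
have [R [st sm]] := prologueP (slots I) Q (compile 9 main_prog).
have cc : code_at (prologue ++ compile 9 main_prog) 9 (compile 9 main_prog).
  by move=> i lti; rewrite onth_cat ltnNge leq_addr addKn.
have [R' [M' [st' [RV _ _]]]] := compileP (isT : wf main_prog) cc sm.
exists (size Q * 6 + 4 + cost (size enc) (nth 0 enc) main_prog zero_store).
  exists (State (9 + size (compile 9 main_prog)) R' M').
    rewrite encodeE; apply: (steps_halts (steps_trans st st')).
    by rewrite size_cat.
  have eps' : ps =i pallets I by move=> x; rewrite eps mem_pallets.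
  have eR : R' 0 = answer Q (slots I) ps by rewrite -ans -RV.
  by rewrite /= eR; case: answerP => // nA; split.
move=> m0; apply: leq_trans (leq_add (leqnn _) cst) _.
have em : size (undup (flatten Q)) = m by rewrite -map_flatten.
have ek : size Q = k by rewrite size_map.
have en : size (flatten Q) = n by rewrite -map_flatten size_map.
rewrite em sum_queue_cost ek en.
have m20 : 0 < m ^ 2 by rewrite expn_gt0 m0.
have t0 : 0 < 3 ^ (m ^ 2) by rewrite expn_gt0.
(* Loops in [try_prog] are nested three deep, so one try costs at most a constant times [m ^ 3]; in
   [power_prog] and [arcs_prog] below they are nested two deep. *)
have lex : m ^ m * (bound try_prog m + 5) <= (bound try_prog 1 + 5) * (m ^ 2 * 3 ^ (m ^ 2)).
  apply: leq_trans (leq_mul (leqnn _) (expn_leq_3 m0)).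
  rewrite mulnCA leq_mul2l; apply/orP; right; rewrite mulnDl.
  apply: leq_add; first exact: (bound_leq try_prog m0).
  by rewrite leq_pmulr // expn_gt0 m0.
apply: leq_trans (time_bound _ _ _ _ _ _ _ m20 t0 lex).
rewrite leq_add2l leq_add2r.
apply: leq_add; last exact: (bound_leq power_prog m0).
rewrite !leq_add2l leq_add2r leq_mul2l; apply/orP; right.
by rewrite leq_add2l; apply: (bound_leq arcs_prog m0).
Qed.
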